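(* Let $G$ be a non-elementary word-hyperbolic group with a marked finite generating set $A$. Let $H \le G$ be a quasiconvex subgroup of infinite index in $G$. Then the Schreier coset graph $\Gamma(G,H,A)$ is non-amenable.
   Context: A marked finite generating set of a group $G$ is a finite alphabet $A$ together with a map $\pi : A \to G$ such that $\pi(A)$ generates $G$. For a subgroup $H \le G$, the Schreier coset graph $\Gamma(G,H,A)$ is the oriented labeled graph whose vertices are the cosets $Hg$, $g\in G$, and whose positively oriented edges are in bijection with pairs $(Hg,a)$, where $a \in A$: the edge $(Hg,a)$ goes from $Hg$ to $Hg\pi(a)$ and is labeled $a$. Edges can be traversed in both directions (traversing an edge labeled $a$ backwards reads $a^{-1}$), so the graph is connected and $2|A|$-regular (loops and multiple edges allowed). $\Gamma(G,A) := \Gamma(G,\{1\},A)$ is the Cayley graph. Each graph carries the simplicial metric in which every edge has length one. $G$ is word-hyperbolic if for any finite generating set $A$ there is $\delta \ge 0$ such that in every geodesic triangle in $\Gamma(G,A)$ each side is contained in the closed $\delta$-neighborhood of the union of the other two sides. A hyperbolic group is non-elementary if it is not virtually cyclic (finite groups count as virtually cyclic). A subgroup $H$ of a word-hyperbolic group $G$ is quasiconvex if for any finite generating set $A$ of $G$ there is $\epsilon \ge 0$ such that every geodesic in $\Gamma(G,A)$ with both endpoints in $H$ is contained in the $\epsilon$-neighborhood of $H$. For a connected graph $X$ of bounded degree, the spectral radius is $\rho(X) := \limsup_{n\to\infty} \sqrt[n]{p^{(n)}(x,y)}$, where $x,y$ are vertices of $X$ and $p^{(n)}(x,y)$ is the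 probability that the simple random walk started at $x$ is at $y$ after $n$ steps (this does not depend on $x,y$, and $\rho(X)\le 1$). $X$ is amenable if $\rho(X)=1$ and non-amenable if $\rho(X)<1$. *)

(* Defs.v *)
From HB Require Import structures.
From mathcomp Require Import all_boot all_order all_algebra finmap.
From mathcomp Require Import all_classical all_reals all_analysis.

Set Implicit Arguments.
Unset Strict Implicit.
Unset Printing Implicit Defensive.

Import Order.TTheory GRing.Theory Num.Theory.

Local Open Scope classical_set_scope.
Local Open Scope ring_scope.

Record graph := Graph {
  vertex : choiceType;
  edge : choiceType;
  src : edge -> vertex;
  tgt : edge -> vertex }.

(* A dart is an edge with a direction of traversal: [(e, true)] runs along the
   orientation of [e] and [(e, false)] against it.  A loop carries two darts,
   so that it contributes 2 to the degree of its vertex. *)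
Definition dart (X : graph) : choiceType := (edge X * bool)%type.

Definition dsrc (X : graph) (d : dart X) : vertex X :=
  if d.2 then src d.1 else tgt d.1.

Definition dtgt (X : graph) (d : dart X) : vertex X :=
  if d.2 then tgt d.1 else src d.1.

Fixpoint walk (X : graph) (n : nat) (x y : vertex X) : Prop :=
  if n is m.+1 then exists2 d : dart X, dsrc d = x & walk m (dtgt d) y
  else x = y.

(* Points of the geometric realization: the vertices, and for each edge [e] the
   points of its interior, at distance [t] from [src e]. *)
Inductive gpoint (R : realType) (X : graph) : Type :=
  | Vertex of vertex X
  | Interior (e : edge X) (t : R) of 0 < t < 1.

Arguments Vertex {R X}.
Arguments Interior {R X}.

(* [(v, a)] is an exit of [p] when a segment of length [a], inside the closed
   edge of [p], joins [p] to the vertex [v]. *)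
Definition exits (R : realType) (X : graph) (p : gpoint R X) :
    set (vertex X * R) :=
  match p with
  | Vertex v => [set (v, 0)]
  | Interior e t _ => [set (src e, t); (tgt e, 1 - t)]
  end.

Definition segment_length (R : realType) (X : graph) (p q : gpoint R X) :
    set R :=
  match p, q with
  | Interior e t _, Interior e' t' _ => [set l | e = e' /\ l = `|t - t'|]
  | _, _ => set0
  end.

(* Lengths of the paths from [p] to [q] that either go through vertices or stay
   inside a single open edge. *)
Definition path_length (R : realType) (X : graph) (p q : gpoint R X) : set R :=
  [set l | exists u a v b n,
     [/\ exits p (u, a), exits q (v, b), walk n u v & l = a + n%:R + b]]
  `|` segment_length p q.

Definition dist (R : realType) (X : graph) (p q : gpoint R X) : R :=
  inf (path_length p q).

Definition geodesic (R : realType) (X : graph) (p q : gpoint R X)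
    (S : set (gpoint R X)) : Prop :=
  exists (L : R) (c : R -> gpoint R X),
    [/\ 0 <= L, c 0 = p, c L = q,
        {in `[0, L] &, forall s t, dist (c s) (c t) = `|s - t|}
      & S = c @` [set` `[0, L]]].

Definition nbhd (R : realType) (X : graph) (r : R) (S : set (gpoint R X)) :
    set (gpoint R X) :=
  [set p | exists2 q, S q & dist p q <= r].

Definition thin_triangles (R : realType) (X : graph) (delta : R) : Prop :=
  forall (x y z : gpoint R X) (S1 S2 S3 : set (gpoint R X)),
    geodesic x y S1 -> geodesic y z S2 -> geodesic z x S3 ->
    [/\ S1 `<=` nbhd delta (S2 `|` S3),
        S2 `<=` nbhd delta (S3 `|` S1)
      & S3 `<=` nbhd delta (S1 `|` S2)].

Definition star (X : graph) (x : vertex X) : set (dart X) :=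
  [set d | dsrc d = x].

Definition degree (X : graph) (x : vertex X) : nat := #|` fset_set (star x)|.

Fixpoint walk_prob (R : realType) (X : graph) (n : nat) (x y : vertex X) : R :=
  if n is m.+1 then
    \sum_(d \in star x) (degree x)%:R^-1 * walk_prob R m (dtgt d) y
  else (x == y)%:R.

Definition spectral_radius (R : realType) (X : graph) (x y : vertex X) :
    \bar R :=
  limn_esup (fun n => (walk_prob R n x y `^ n%:R^-1)%:E).

(* The spectral radius of a connected graph does not depend on [x] and [y]. *)
Definition nonamenable (R : realType) (X : graph) : Prop :=
  forall x y : vertex X, (spectral_radius R x y < 1)%E.

Definition subgroup (G : groupType) (H : set G) : Prop :=
  group_closed (mem H).

Definition generates (G : groupType) (A : Type) (pi : A -> G) : Prop :=
  forall K : set G, subgroup K -> range pi `<=` K -> K = setT.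

Definition rcos (G : groupType) (H : set G) (g : G) : set G :=
  [set (h * g)%g | h in H].

Definition right_cosets (G : groupType) (H : set G) : set (set G) :=
  range (rcos H).

Definition coset_type (G : groupType) (H : set G) : choiceType :=
  set_type (right_cosets H).

Lemma rcos_in (G : groupType) (H : set G) (g : G) :
  rcos H g \in right_cosets H.
Proof. by apply/mem_set; exists g. Qed.

Definition coset_elt (G : groupType) (H : set G) (g : G) : coset_type H :=
  exist _ (rcos H g) (rcos_in H g).

Lemma coset_mul_in (G : groupType) (H : set G) (C : coset_type H) (g : G) :
  rcos (val C) g \in right_cosets H.
Proof.
case: C => C /= /set_mem [k _ <-]; apply/mem_set; exists (k * g)%g => //.
by apply/seteqP; split=> [_ [h Hh <-]|_ [_ [h Hh <-] <-]];
  [exists (h * k)%g; [exists h|rewrite mulgA] | exists h; rewrite ?mulgA].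
Qed.

Definition coset_mul (G : groupType) (H : set G) (C : coset_type H) (g : G) :
    coset_type H :=
  exist _ (rcos (val C) g) (coset_mul_in C g).

Definition schreier_graph (G : groupType) (H : set G) (A : finType)
    (pi : A -> G) : graph :=
  @Graph (coset_type H) (coset_type H * A)%type
    (fun e => e.1) (fun e => coset_mul e.1 (pi e.2)).

Definition cayley_graph (G : groupType) (A : finType) (pi : A -> G) : graph :=
  schreier_graph [set 1%g] pi.

Definition cayley_point (R : realType) (G : groupType) (A : finType)
    (pi : A -> G) (g : G) : gpoint R (cayley_graph pi) :=
  @Vertex R (cayley_graph pi) (coset_elt [set 1%g] g).

Definition word_hyperbolic (R : realType) (G : groupType) : Prop :=
  forall (A : finType) (pi : A -> G), generates pi ->
    exists2 delta : R, 0 <= delta & thin_triangles (cayley_graph pi) delta.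

Definition finite_index (G : groupType) (H : set G) : Prop :=
  finite_set (right_cosets H).

Definition cyclic_subgroup (G : groupType) (g : G) : set G :=
  [set x | exists n : nat, x = (g ^+ n)%g \/ x = (g ^- n)%g].

Definition virtually_cyclic (G : groupType) : Prop :=
  exists g : G, finite_index (cyclic_subgroup g).

Definition quasiconvex (R : realType) (G : groupType) (H : set G) : Prop :=
  forall (A : finType) (pi : A -> G), generates pi ->
    exists2 epsilon : R, 0 <= epsilon &
      forall (h k : G) (S : set (gpoint R (cayley_graph pi))),
        H h -> H k -> geodesic (cayley_point R pi h) (cayley_point R pi k) S ->
        S `<=` nbhd epsilon (cayley_point R pi @` H).

(* Main.v *)
Require Import Defs.
From mathcomp Require Import all_boot all_order all_algebra finmap.
From mathcomp Require Import all_classical all_reals all_analysis.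
From mathcomp Require Import ring lra zify.

(** The idea is to show that, seen from [H], the Schreier graph branches faster
   than it merges.  Write [|C|] for the least length of an element of the coset
   [C], and call [v] an outward step at [C] when [|C v| >= |C| + len v - c0] for
   a fixed constant [c0].

   Outward steps abound.  A hyperbolic group that is not virtually cyclic has
   tripods: three elements as long as one likes whose pairwise Gromov products
   stay below a fixed constant [virtually_cyclic_of_no_tripod].  Whatever
   direction is to be avoided, two of the three arms avoid it; iterating this
   choice grows a binary tree of quasi-geodesic words, so there are [2 ^ m]
   different elements of length [O(m)] that all avoid a prescribed direction
   [binary_tree].  By quasiconvexity, the points of [H] all lie in one direction
   when seen from a point [g] far from [H] [subgroup_coherent], so the elements
   of the tree are outward steps at [H g].  Cosets near [H] are first moved to a
   fixed far coset, which exists because [H] has infinite index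
   [outward_steps].

   Outward steps into a given coset are rare.  If [v] is an outward step from
   [H g v^-1] to [H g], then [g v^-1] lies near a geodesic from [g] to its
   projection on [H].  Hyperbolicity then confines the [v] of a given length to
   a translate of a ball of fixed radius, so at most [O(K)] of them have length
   at most [K] [inward_steps].

   As [2 ^ m] outgrows [O(m)], summing [f(x)^2 <= 2 f(x v)^2 + 2 (f(x) - f(x v))^2]
   over the outward steps [(x, v)] gives a Poincare inequality: the Dirichlet
   form controls the squared norm of every finitely supported function
   [poincare_of_expansion].  Hence the Markov operator has norm at most
   some [lam < 1] [markov_contract], the transition probabilities in [n] steps
   are at most [lam ^ n], and the spectral radius is at most [lam].

   Hyperbolicity is used as the four-point inequality for the word metric.  It
   is deduced from thin triangles in the geometric realization with the help of
   the distance to a vertex extended to edges, which is 1-Lipschitz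
   [potential_le_dist]. *)

Set Implicit Arguments.
Unset Strict Implicit.
Unset Printing Implicit Defensive.

Import Order.TTheory GRing.Theory Num.Theory.

Local Open Scope classical_set_scope.
Local Open Scope ring_scope.

(** * Sums of finitely supported functions *)

Section FiniteSums.
Variables (R : realType) (V : choiceType).
Implicit Types f g : V -> R.

Definition fin_supp f := finite_set (f @^-1` [set~ 0]).

Definition fsum f : R := \sum_(x \in setT) f x.

Lemma fin_suppS f g : (forall x, f x = 0 -> g x = 0) -> fin_supp f -> fin_supp g.
Proof. by move=> fg; apply: sub_finite_set => x /= gx /fg. Qed.

Lemma fin_suppU f g h : (forall x, f x = 0 -> g x = 0 -> h x = 0) ->
  fin_supp f -> fin_supp g -> fin_supp h.
Proof.
move=> fgh ff fg; apply: (@sub_finite_set _ _ (f @^-1` [set~ 0] `|` g @^-1` [set~ 0])).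
  move=> x /= hx; apply/not_andP => -[fx gx].
  by apply: hx; apply: fgh.
by rewrite finite_setU.
Qed.

Lemma fin_suppD f g : fin_supp f -> fin_supp g -> fin_supp (fun x => f x + g x).
Proof. by apply: fin_suppU => x -> ->; rewrite addr0. Qed.

Lemma fsumE (A : {fset V}) f : (f @^-1` [set~ 0] `<=` [set` A]) ->
  fsum f = \sum_(x <- A) f x.
Proof.
move=> fA; apply: fsbigTE => x xA; apply: contrapT => fx.
by move/negP: xA; apply; apply: fA.
Qed.

Lemma fsumD f g : fin_supp f -> fin_supp g ->
  fsum (fun x => f x + g x) = fsum f + fsum g.
Proof.
move=> ff fg; set A := fset_set (f @^-1` [set~ 0] `|` g @^-1` [set~ 0]).
have fU : finite_set (f @^-1` [set~ 0] `|` g @^-1` [set~ 0]) by rewrite finite_setU.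
have AE : [set` A] = f @^-1` [set~ 0] `|` g @^-1` [set~ 0] by rewrite /A fset_setK.
have AP h : h @^-1` [set~ 0] `<=` [set` A] -> fsum h = \sum_(x <- A) h x by exact: fsumE.
rewrite (AP f); last by rewrite AE => x; left.
rewrite (AP g); last by rewrite AE => x; right.
rewrite AP ?big_split// AE => x /= fgx; apply/not_andP => -[fx gx].
by apply: fgx; rewrite fx gx addr0.
Qed.

Lemma fsumZ a f : fsum (fun x => a * f x) = a * fsum f.
Proof. by rewrite /fsum mulr_fsumr. Qed.

Lemma fsum_ge0 f : (forall x, 0 <= f x) -> 0 <= fsum f.
Proof. by move=> f0; apply: fsumr_ge0. Qed.

Lemma fsum0 : fsum (fun=> 0) = 0.
Proof. exact: fsbig1. Qed.

Lemma ler_fsum f g : fin_supp f -> fin_supp g -> (forall x, f x <= g x) ->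
  fsum f <= fsum g.
Proof.
move=> ff fg fg_le; have fgf : fin_supp (fun x => g x - f x).
  by move: ff fg; apply: fin_suppU => x -> ->; rewrite subr0.
have -> : g = fun x => f x + (g x - f x) by apply/funext => x; rewrite addrC subrK.
by rewrite fsumD// lerDl fsum_ge0// => x; rewrite subr_ge0.
Qed.

Lemma fin_supp_sum (I : Type) (r : seq I) (F : I -> V -> R) :
  (forall i, fin_supp (F i)) -> fin_supp (fun x => \sum_(i <- r) F i x).
Proof.
move=> fF; elim: r => [|i r IH].
  rewrite /fin_supp (_ : _ @^-1` _ = set0)//.
  by apply/seteqP; split => x //=; rewrite big_nil.
move: (fF i) IH; apply: fin_suppU => x Fx; rewrite big_cons Fx add0r//.
Qed.

Lemma fsum_sum (I : Type) (r : seq I) (F : I -> V -> R) :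
  (forall i, fin_supp (F i)) ->
  fsum (fun x => \sum_(i <- r) F i x) = \sum_(i <- r) fsum (F i).
Proof.
move=> fF; elim: r => [|i r IH].
  by rewrite big_nil -[RHS]fsum0; congr fsum; apply/funext => x; rewrite big_nil.
rewrite big_cons -IH -fsumD//; last exact: fin_supp_sum.
by congr fsum; apply/funext => x; rewrite big_cons.
Qed.

Lemma fsum_bij f (t t' : V -> V) : cancel t t' -> cancel t' t ->
  fsum (f \o t) = fsum f.
Proof. by move=> tK t'K; rewrite /fsum [RHS](reindex_fsbigT t)//; exists t'. Qed.

Lemma fin_supp_inj f (t : V -> V) : injective t -> fin_supp f -> fin_supp (f \o t).
Proof.
move=> ti ff; apply: (@finite_preimage _ _ (f @^-1` [set~ 0]) t) => //.
by move=> ? ? _ _; apply: ti.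
Qed.

Lemma ler_fsum_sqr f x : fin_supp f -> f x ^+ 2 <= fsum (fun y => f y ^+ 2).
Proof.
move=> ff.
have -> : f x ^+ 2 = fsum (fun y => (y == x)%:R * f y ^+ 2).
  rewrite (@fsumE (fset1 x)) ?big_seq_fset1 ?eqxx ?mul1r// => y /=.
  by rewrite inE; case: eqP => //; rewrite mul0r.
have f2 : fin_supp (fun y => f y ^+ 2) by move: ff; apply: fin_suppS => y ->; rewrite expr0n.
apply: ler_fsum => //; first by move: f2; apply: fin_suppS => y ->; rewrite mulr0.
by move=> y; case: eqP; rewrite ?mul1r ?mul0r ?sqr_ge0.
Qed.

End FiniteSums.

(** * Expansion of a group action and the spectral gap *)

Section Action.
Variables (R : realType) (V : choiceType) (G : groupType) (act : V -> G -> V).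
Hypothesis act1 : forall x, act x 1%g = x.
Hypothesis actM : forall x g h, act (act x g) h = act x (g * h)%g.
Implicit Types f : V -> R.

Lemma actK g : cancel (act^~ g) (act^~ g^-1%g).
Proof. by move=> x; rewrite actM mulgV act1. Qed.

Lemma actVK g : cancel (act^~ g^-1%g) (act^~ g).
Proof. by move=> x; rewrite actM mulVg act1. Qed.

Lemma fsum_act f g : fsum (fun x => f (act x g)) = fsum f.
Proof. exact: (fsum_bij f (actK g) (actVK g)). Qed.

Lemma fin_supp_act f g : fin_supp f -> fin_supp (fun x => f (act x g)).
Proof. exact: (fin_supp_inj (can_inj (actK g))). Qed.

(** The squared l^2 norm of [f - f . g]: how far [f] is from being [g]-invariant. *)
Definition disp g f : R := fsum (fun x => (f x - f (act x g)) ^+ 2).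

Lemma fin_supp_disp g f : fin_supp f ->
  fin_supp (fun x => (f x - f (act x g)) ^+ 2).
Proof.
move=> ff; move: ff (fin_supp_act g ff).
by apply: fin_suppU => x -> ->; rewrite subr0 expr0n.
Qed.

Lemma disp_ge0 g f : 0 <= disp g f.
Proof. by apply: fsum_ge0 => x; apply: sqr_ge0. Qed.

Lemma disp1 f : disp 1%g f = 0.
Proof.
rewrite -[RHS](@fsum0 R V); congr fsum; apply/funext => x.
by rewrite act1 subrr expr0n.
Qed.

Lemma dispV g f : disp g^-1%g f = disp g f.
Proof.
rewrite /disp -(fsum_act _ g); congr fsum; apply/funext => x.
by rewrite actM mulgV act1 -sqrrN opprB.
Qed.

Lemma dispM g h f : fin_supp f -> disp (g * h)%g f <= 2 * disp g f + 2 * disp h f.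
Proof.
move=> ff; rewrite -[X in _ + 2 * X](fsum_act _ g) -!fsumZ.
have fg := fin_supp_disp g ff.
have fh := fin_supp_act g (fin_supp_disp h ff).
have f2g : fin_supp (fun x => 2 * (f x - f (act x g)) ^+ 2).
  by move: fg; apply: fin_suppS => x ->; rewrite mulr0.
have f2h : fin_supp (fun x => 2 * (f (act x g) - f (act (act x g) h)) ^+ 2).
  by move: fh; apply: fin_suppS => x ->; rewrite mulr0.
rewrite -fsumD//; apply: ler_fsum; [exact: fin_supp_disp|exact: fin_suppD|].
move=> x; rewrite actM; have := sqr_ge0 (f x - f (act x g) *+ 2 + f (act x (g * h)%g)).
by rewrite !expr2; nra.
Qed.

Variables (A : finType) (pi : A -> G).

Definition dirichlet f : R := \sum_(a : A) disp (pi a) f.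

Lemma dirichlet_ge0 f : 0 <= dirichlet f.
Proof. by apply: sumr_ge0 => a _; apply: disp_ge0. Qed.

(** The elements whose displacement is controlled by the Dirichlet form are
   closed under products and inverses, and contain the generators. *)
Lemma disp_le_dirichlet g : generates pi ->
  exists2 C : R, 0 <= C & forall f, fin_supp f -> disp g f <= C * dirichlet f.
Proof.
move=> gen; pose K : set G := [set g | exists2 C : R, 0 <= C &
  forall f, fin_supp f -> disp g f <= C * dirichlet f].
suff KT : K = setT by have : K g by rewrite KT.
apply: gen.
- split; first by apply/mem_set; exists 0 => // f _; rewrite disp1 mul0r.
  move=> a b /set_mem[C C0 aC] /set_mem[D D0 bD]; apply/mem_set.
  exists (2 * C + 2 * D); first by rewrite addr_ge0// mulr_ge0.
  move=> f ff; have := dispM a b^-1%g ff; rewrite dispV.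
  have := aC f ff; have := bD f ff; lra.
- move=> _ [a _ <-]; exists 1 => // f ff; rewrite mul1r /dirichlet (bigD1 a)//= lerDl.
  by apply: sumr_ge0 => ? _; apply: disp_ge0.
Qed.

Lemma sum_disp_le_dirichlet (T : seq G) : generates pi ->
  exists2 C : R, 0 <= C &
    forall f, fin_supp f -> \sum_(v <- T) disp v f <= C * dirichlet f.
Proof.
move=> gen; elim: T => [|v T [C C0 TC]].
  by exists 0 => // f _; rewrite big_nil mul0r.
have [D D0 vD] := disp_le_dirichlet v gen.
exists (D + C); first exact: addr_ge0.
by move=> f ff; rewrite big_cons mulrDl lerD// ?vD ?TC.
Qed.

(** If every point has [N] steps [v] leaving it in [E] while at most [N / 4]
   steps enter it, then mass cannot be nearly invariant.  Bounding [f(x)^2] by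
   [2 f(x v)^2 + 2 (f(x) - f(x v))^2] and summing over [E], the left side counts
   each point at least [N] times and the first term on the right at most [2 M <= N / 2]
   times, so the displacements have to make up for the difference. *)
Lemma poincare_of_expansion (T : seq G) (E : V -> G -> bool) (N M : nat) :
  generates pi -> (0 < N)%N -> (4 * M <= N)%N ->
  (forall x, N <= count (E x) T)%N ->
  (forall y, count (fun v => E (act y v^-1%g) v) T <= M)%N ->
  exists2 C : R, 0 <= C &
    forall f, fin_supp f -> fsum (fun x => f x ^+ 2) <= C * dirichlet f.
Proof.
move=> gen N0 MN out inn; have [C C0 TC] := sum_disp_le_dirichlet T gen.
exists (4 * C) => [|f ff]; first by rewrite mulr_ge0.
have fsq : fin_supp (fun x => f x ^+ 2).
  by move: ff; apply: fin_suppS => x ->; rewrite expr0n.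
have fZ (k : R) h : fin_supp h -> fin_supp (fun x => k * h x).
  by apply: fin_suppS => x ->; rewrite mulr0.
pose F v x : R := (E x v)%:R * f (act x v) ^+ 2.
have fF v : fin_supp (F v).
  move: (fin_supp_act v fsq); apply: fin_suppS => x; rewrite /F => ->.
  by rewrite mulr0.
have countE (p : pred G) : (count p T)%:R = \sum_(v <- T) (p v)%:R :> R.
  rewrite -sum1_count big_mkcond/= natr_sum.
  by apply: eq_bigr => v _; case: (p v).
(* Reindexing each sum by y = x v groups the steps by their endpoint. *)
have inM : \sum_(v <- T) fsum (F v) <= M%:R * fsum (fun x => f x ^+ 2).
  rewrite [leLHS](_ : _ =
      \sum_(v <- T) fsum (fun y => (E (act y v^-1%g) v)%:R * f y ^+ 2)).
    rewrite -fsum_sum -?fsumZ.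
      apply: ler_fsum; last by move=> y; rewrite -mulr_suml -countE ler_wpM2r ?sqr_ge0// ler_nat.
        apply: fin_supp_sum => v; move: fsq; apply: fin_suppS => x ->; by rewrite mulr0.
      exact: fZ.
    by move=> v; move: fsq; apply: fin_suppS => x ->; rewrite mulr0.
  apply: eq_bigr => v _; rewrite -[RHS](fsum_act _ v); congr fsum.
  by apply/funext => x; rewrite /F actM mulgV act1.
have outN : N%:R * fsum (fun x => f x ^+ 2) <=
    2 * (\sum_(v <- T) fsum (F v)) + 2 * \sum_(v <- T) disp v f.
  rewrite -!fsum_sum// ?/disp; last by move=> v; apply: fin_supp_disp.
  rewrite -!fsumZ -fsumD; first last.
  - by apply: fZ; apply: fin_supp_sum => v; apply: fin_supp_disp.
  - by apply: fZ; apply: fin_supp_sum.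
  apply: ler_fsum; first exact: fZ.
    apply: fin_suppD; apply: fZ; apply: fin_supp_sum => // v; exact: fin_supp_disp.
  move=> x; apply: (@le_trans _ _ ((count (E x) T)%:R * f x ^+ 2)).
    by rewrite ler_wpM2r ?sqr_ge0// ler_nat.
  rewrite countE mulr_suml -mulrDr -big_split mulr_sumr ler_sum//= => v _.
  rewrite /F; case: (E x v); rewrite ?mul1r ?mul0r ?add0r.
    have := sqr_ge0 (f x - f (act x v) *+ 2); rewrite !expr2; nra.
  by rewrite mulr_ge0 ?sqr_ge0.
have I0 : 0 <= fsum (fun x => f x ^+ 2) by apply: fsum_ge0 => x; apply: sqr_ge0.
have {}TC := TC f ff.
have N1 : (1 : R) <= N%:R by rewrite ler1n.
have M4 : 4 * M%:R <= N%:R :> R by rewrite -natrM ler_nat.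
nra.
Qed.

Definition markov_op f (x : V) : R :=
  (2 * #|A|)%:R^-1 * \sum_(a : A) (f (act x (pi a)) + f (act x (pi a)^-1%g)).

Lemma fin_supp_markov f : fin_supp f -> fin_supp (markov_op f).
Proof.
move=> ff; apply: (@fin_suppS _ _ (fun x => \sum_(a : A) (f (act x (pi a)) + f (act x (pi a)^-1%g)))).
  by move=> x; rewrite /markov_op => ->; rewrite mulr0.
by apply: fin_supp_sum => a; apply: fin_suppD; apply: fin_supp_act.
Qed.

Lemma markovD f g t x : markov_op (fun y => f y + t * g y) x = markov_op f x + t * markov_op g x.
Proof.
rewrite /markov_op [t * (_ * _)]mulrCA -mulrDr [t * _]mulr_sumr -big_split/=; congr (_ * _).
by apply: eq_bigr => a _; rewrite !mulrDr addrACA.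
Qed.

Lemma fsumM_markov f g : fin_supp f ->
  fsum (fun x => f x * markov_op g x) = (2 * #|A|)%:R^-1 *
    \sum_(a : A) (fsum (fun x => f x * g (act x (pi a))) +
                  fsum (fun x => f (act x (pi a)) * g x)).
Proof.
move=> ff; have fM (k : V -> R) : fin_supp (fun x => f x * k x).
  by move: ff; apply: fin_suppS => x ->; rewrite mul0r.
have step a : fsum (fun x => f x * g (act x (pi a))) + fsum (fun x => f (act x (pi a)) * g x) =
    fsum (fun x => f x * g (act x (pi a)) + f x * g (act x (pi a)^-1%g)).
  rewrite fsumD//; congr (_ + _); rewrite -[RHS](fsum_act _ (pi a)); congr fsum.
  by apply/funext => x; rewrite actM mulgV act1.
under [in RHS]eq_bigr do rewrite step.
rewrite -fsum_sum; last by move=> a; apply: fin_suppD.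
rewrite -fsumZ; congr fsum; apply/funext => x; rewrite /markov_op mulrCA; congr (_ * _).
by rewrite mulr_sumr; apply: eq_bigr => a _; rewrite mulrDr.
Qed.

Lemma fsumM_markovC f g : fin_supp f -> fin_supp g ->
  fsum (fun x => f x * markov_op g x) = fsum (fun x => g x * markov_op f x).
Proof.
move=> ff fg; rewrite !fsumM_markov//; congr (_ * _); apply: eq_bigr => a _.
by rewrite addrC; congr (_ + _); congr fsum; apply/funext => x; rewrite mulrC.
Qed.

Lemma disp_expand g f : fin_supp f ->
  disp g f = 2 * fsum (fun x => f x ^+ 2) - 2 * fsum (fun x => f x * f (act x g)).
Proof.
move=> ff; have fsq : fin_supp (fun x => f x ^+ 2).
  by move: ff; apply: fin_suppS => x ->; rewrite expr0n.
have fsqg := fin_supp_act g fsq.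
rewrite mulr_natl mulr2n -{2}(fsum_act _ g) -fsumD// -mulNr -fsumZ -fsumD.
- by congr fsum; apply/funext => x; ring.
- exact: fin_suppD.
- by move: ff; apply: fin_suppS => x ->; rewrite mul0r mulr0.
Qed.

(** The Dirichlet form is the quadratic form of the Laplacian [1 - P]. *)
Lemma markov_form f : (0 < #|A|)%N -> fin_supp f ->
  fsum (fun x => f x * markov_op f x) =
  fsum (fun x => f x ^+ 2) - (2 * #|A|)%:R^-1 * dirichlet f.
Proof.
move=> A0 ff; rewrite fsumM_markov//.
under eq_bigr => a _.
  rewrite (_ : fsum (fun x => f (act x (pi a)) * f x) = fsum (fun x => f x * f (act x (pi a)))).
    over.
  by congr fsum; apply/funext => x; rewrite mulrC.
have -> : dirichlet f = 2 * #|A|%:R * fsum (fun x => f x ^+ 2) -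
    \sum_(a : A) (fsum (fun x => f x * f (act x (pi a))) + fsum (fun x => f x * f (act x (pi a)))).
  have c (k : R) : #|A|%:R * k = \sum_(a : A) k by rewrite sumr_const mulr_natl.
  rewrite /dirichlet -mulrA mulrCA c -sumrB.
  by apply: eq_bigr => a _; rewrite disp_expand//; ring.
have A0' : #|A|%:R != 0 :> R by rewrite pnatr_eq0 -lt0n.
by rewrite natrM; field.
Qed.

(** The Poincare inequality bounds the quadratic form of the Markov operator
   [P] from above by [lam]; as [P] has nonnegative coefficients, passing to
   [`|f|] bounds it from below by [- lam] too.  Since [P] is symmetric,
   polarization turns the bound on the form into a bound on the norm. *)
Lemma markov_contract : (0 < #|A|)%N ->
  (exists2 C : R, 0 <= C &
    forall f, fin_supp f -> fsum (fun x => f x ^+ 2) <= C * dirichlet f) ->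
  exists2 lam : R, 0 < lam < 1 & forall f, fin_supp f ->
    fsum (fun x => markov_op f x ^+ 2) <= lam ^+ 2 * fsum (fun x => f x ^+ 2).
Proof.
move=> A0 [C C0 poinc]; set r : R := (2 * #|A|)%:R.
have r2 : 2 <= r by rewrite /r natrM ler_peMr// ler1n.
pose lam := 1 - (r * (C + 1))^-1; have rC : 1 < r * (C + 1) by nra.
have lam01 : 0 < lam < 1.
  by rewrite /lam subr_gt0 invf_lt1 ?gtrBl ?invr_gt0 ?rC//; lra.
exists lam => //; case/andP: lam01 => lam0 lam1.
have fZ (k : R) h : fin_supp h -> fin_supp (fun x => k * h x).
  by apply: fin_suppS => x ->; rewrite mulr0.
have fM (f k : V -> R) : fin_supp f -> fin_supp (fun x => f x * k x).
  by apply: fin_suppS => x ->; rewrite mul0r.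
have upper f : fin_supp f ->
    fsum (fun x => f x * markov_op f x) <= lam * fsum (fun x => f x ^+ 2).
  move=> ff; rewrite markov_form// -/r /lam mulrBl mul1r lerD2l lerN2.
  rewrite invfM -mulrA ler_pM2l ?invr_gt0; last lra.
  rewrite ler_pdivrMl; last lra.
  apply: (le_trans (poinc f ff)); rewrite ler_wpM2r ?dirichlet_ge0//; lra.
have lower f : fin_supp f ->
    - fsum (fun x => f x * markov_op f x) <= lam * fsum (fun x => f x ^+ 2).
  move=> ff; pose h x := `|f x|.
  have fh : fin_supp h by move: ff; apply: fin_suppS => x; rewrite /h => ->; rewrite normr0.
  have -> : fsum (fun x => f x ^+ 2) = fsum (fun x => h x ^+ 2).
    by congr fsum; apply/funext => x; rewrite /h real_normK// num_real.
  apply: le_trans (upper h fh); rewrite -mulN1r -fsumZ.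
  apply: ler_fsum; [by apply: fZ; apply: fM|exact: fM|] => x.
  rewrite mulN1r; apply: le_trans (ler_norm _) _; rewrite normrN normrM ler_wpM2l//.
  rewrite /markov_op normrM ger0_norm ?invr_ge0 ?ler0n// ler_wpM2l ?invr_ge0 ?ler0n//.
  apply: le_trans (ler_norm_sum _ _ _) _; apply: ler_sum => a _; exact: ler_normD.
move=> f ff; set g := markov_op f; have fg : fin_supp g by apply: fin_supp_markov.
(* Polarize with f and g = P f; the weight t = lam^-1 on g is the optimal one. *)
pose t := lam^-1; have t0 : 0 < t by rewrite invr_gt0.
pose u x := f x + t * g x; pose w x := f x + (- t) * g x.
have fu : fin_supp u by apply: fin_suppD => //; apply: fZ.
have fw : fin_supp w by apply: fin_suppD => //; apply: fZ.
have fsq (h : V -> R) : fin_supp h -> fin_supp (fun x => h x ^+ 2).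
  by apply: fin_suppS => x ->; rewrite expr0n.
have e1 : fsum (fun x => u x * markov_op u x) - fsum (fun x => w x * markov_op w x) =
    4 * t * fsum (fun x => g x ^+ 2).
  have -> : 4 * t * fsum (fun x => g x ^+ 2) =
     2 * t * (fsum (fun x => f x * markov_op g x) + fsum (fun x => g x * markov_op f x)).
    by rewrite (fsumM_markovC ff fg) -/g; under [in RHS]eq_fun do rewrite -expr2; ring.
  rewrite -mulN1r -fsumZ -!fsumD -?fsumZ.
  - by congr fsum; apply/funext => x; rewrite /u /w !markovD; ring.
  - exact: fM.
  - exact: fM.
  - exact: fM.
  - by apply: fZ; apply: fM.
have e2 : fsum (fun x => u x ^+ 2) + fsum (fun x => w x ^+ 2) =
    2 * fsum (fun x => f x ^+ 2) + 2 * t ^+ 2 * fsum (fun x => g x ^+ 2).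
  rewrite -!fsumZ -!fsumD; [|exact/fZ/fsq|exact/fZ/fsq|exact: fsq|exact: fsq].
  by congr fsum; apply/funext => x; rewrite /u /w; ring.
have := upper u fu; have := lower w fw; set I := fsum (fun x => f x ^+ 2) in e2 *.
move: e1 e2; set J := fsum (fun x => g x ^+ 2).
set Iu := fsum (fun x => u x ^+ 2); set Iw := fsum (fun x => w x ^+ 2).
move=> e1 e2 lw up; have : 4 * t * J <= lam * (2 * I + 2 * t ^+ 2 * J).
  by rewrite -e1 -e2 mulrDr; lra.
have lt : lam * t = 1 by rewrite mulfV// gt_eqF.
have -> : lam * (2 * I + 2 * t ^+ 2 * J) = 2 * lam * I + 2 * (lam * t) * t * J by ring.
rewrite lt mulr1 => h; have {}h : t * J <= lam * I by lra.
by have := ler_wpM2l (ltW lam0) h; rewrite mulrA lt mul1r mulrA expr2.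
Qed.

End Action.

(** * The simple random walk on a Schreier graph *)

Section Schreier.
Variables (G : groupType) (H : set G).
Implicit Types (C : coset_type H) (g h : G).

Lemma rcos1 (S : set G) : rcos S 1%g = S.
Proof.
by apply/seteqP; split=> [_ [h Sh <-]|h Sh]; [rewrite mulg1|exists h; rewrite ?mulg1].
Qed.

Lemma rcosM (S : set G) g h : rcos (rcos S g) h = rcos S (g * h)%g.
Proof.
apply/seteqP; split=> [_ [_ [k Sk <-] <-]|_ [k Sk <-]].
  by exists k; rewrite ?mulgA.
by exists (k * g)%g; [exists k|rewrite mulgA].
Qed.

Lemma coset_mul1 C : coset_mul C 1%g = C.
Proof. by apply: val_inj; rewrite /= rcos1. Qed.

Lemma coset_mulM C g h : coset_mul (coset_mul C g) h = coset_mul C (g * h)%g.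
Proof. by apply: val_inj; rewrite /= rcosM. Qed.

Lemma coset_elt_mul g h : coset_mul (coset_elt H g) h = coset_elt H (g * h)%g.
Proof. by apply: val_inj; rewrite /= rcosM. Qed.

Lemma coset_eltP C : exists g, C = coset_elt H g.
Proof. by case: C => C /[dup] /set_mem [g _ gC] CP; exists g; apply: val_inj. Qed.

Variables (A : finType) (pi : A -> G).
Notation X := (schreier_graph H pi).

(** The edge labelled [a] that arrives at [C] starts at [C (pi a)^-1]; it is
   traversed backwards. *)
Definition exit_dart (C : vertex X) (p : A * bool) : dart X :=
  if p.2 then ((C, p.1), true) else ((coset_mul C (pi p.1)^-1%g, p.1), false).

Lemma exit_dart_inj C : injective (exit_dart C).
Proof. by move=> [a []] [b []] //= [] *; subst. Qed.

Lemma dtgt_exit C a (b : bool) :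
  dtgt (exit_dart C (a, b)) = coset_mul C (if b then pi a else (pi a)^-1%g).
Proof. by case: b. Qed.

Lemma star_exit C : @star X C = [set` [seq exit_dart C p | p <- enum {: A * bool}]].
Proof.
apply/seteqP; split=> [d|d /= /mapP[[a []] _ ->]]; last 2 first.
- by [].
- by rewrite /star /exit_dart /dsrc /= coset_mulM mulVg coset_mul1.
case: d => [[D a] b]; rewrite /star /dsrc /= => dC; apply/mapP; exists (a, b).
  by rewrite mem_enum.
case: b dC => /= <- //; rewrite /exit_dart/=.
by rewrite coset_mulM mulgV coset_mul1.
Qed.

Lemma degree_schreier C : @degree X C = (2 * #|A|)%N.
Proof.
rewrite /degree star_exit; set s := map _ _.
have us : uniq s by rewrite map_inj_uniq ?enum_uniq//; exact: exit_dart_inj.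
have -> : fset_set [set` s] = [fset x in s]%fset.
  by apply/fsetP => x; rewrite in_fset_set// !inE mem_setE.
rewrite card_fseq undup_id// size_map -cardE card_prod card_bool mulnC//.
Qed.

Lemma sum_star (R : realType) C (F : dart X -> R) :
  \sum_(d \in @star X C) F d =
  \sum_(a : A) (F (exit_dart C (a, true)) + F (exit_dart C (a, false))).
Proof.
rewrite star_exit -fsbig_seq; last first.
  by rewrite map_inj_uniq ?enum_uniq//; exact: exit_dart_inj.
rewrite big_map big_enum/= -(pair_big xpredT xpredT (fun a b => F (exit_dart C (a, b))))/=.
by apply: eq_bigr => a _; rewrite big_bool.
Qed.

Variable R : realType.

Lemma walk_prob_markov n (y : vertex X) :
  @walk_prob R X n ^~ y = iter n (markov_op (@coset_mul G H) pi) (fun x => (x == y)%:R : R).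
Proof.
elim: n => [//|n IH]; apply/funext => x /=.
rewrite -IH sum_star /markov_op degree_schreier mulr_sumr.
by apply: eq_bigr => a _; rewrite mulrDr.
Qed.

Lemma walk_prob_ge0 n (x y : vertex X) : 0 <= @walk_prob R X n x y.
Proof.
elim: n x => [|n IH] x /=; first by rewrite ler0n.
by apply: fsumr_ge0 => d _; rewrite mulr_ge0 ?invr_ge0.
Qed.

(** The function [x |-> walk_prob n x y] is the [n]-th image of the indicator
   of [y] under the Markov operator, so its l^2 norm, and a fortiori each of its
   values, is at most [lam ^ n]. *)
Lemma nonamenable_of_contract (lam : R) : 0 < lam < 1 ->
  (forall f : coset_type H -> R, fin_supp f ->
    fsum (fun x => markov_op (@coset_mul G H) pi f x ^+ 2) <= lam ^+ 2 * fsum (fun x => f x ^+ 2)) ->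
  nonamenable R X.
Proof.
case/andP=> lam0 lam1 contr x y; pose d z : R := (z == y)%:R.
have fd : fin_supp d.
  apply: (@sub_finite_set _ _ [set y]); last exact: finite_set1.
  by move=> z /=; rewrite /d; case: eqP.
have d1 : fsum (fun z => d z ^+ 2) = 1.
  rewrite (@fsumE _ _ (fset1 y)) ?big_seq_fset1 /d ?eqxx ?expr1n// => z /=.
  by rewrite inE; case: eqP => //; rewrite expr0n.
pose q n : coset_type H -> R := @walk_prob R X n ^~ y.
have qS n : q n.+1 = markov_op (@coset_mul G H) pi (q n).
  by rewrite /q !walk_prob_markov.
have pn n : fin_supp (q n) /\ fsum (fun z => q n z ^+ 2) <= (lam ^+ n) ^+ 2.
  elim: n => [|n [fn IH]]; first by rewrite expr0 expr1n -d1.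
  rewrite qS; split; first exact: (fin_supp_markov coset_mul1 coset_mulM).
  apply: (le_trans (contr _ fn)); rewrite [lam ^+ n.+1]exprS exprMn.
  by rewrite ler_wpM2l// sqr_ge0.
have pl n : @walk_prob R X n x y <= lam ^+ n.
  have [fn sn] := pn n; have := le_trans (ler_fsum_sqr x fn) sn.
  by rewrite ler_pXn2r// nnegrE ?walk_prob_ge0// exprn_ge0// ltW.
apply: (@le_lt_trans _ _ lam%:E); last by rewrite lte_fin.
rewrite /spectral_radius /limn_esup /limf_esup.
(* The term n = 0, which is 1, has to be left out of the upper limit. *)
apply: (@le_trans _ _ (ereal_sup ((fun n => (@walk_prob R X n x y `^ n%:R^-1)%:E) @` [set n | (0 < n)%N]))).
  apply: ereal_inf_lbound; exists [set n | (0 < n)%N] => //.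
  exact: nbhs_infty_gt.
apply: ge_ereal_sup => _ [n /= n0 <-]; rewrite lee_fin.
have -> : lam = (lam ^+ n) `^ n%:R^-1.
  by rewrite -powR_mulrn ?ltW// -powRrM mulfV ?powRr1 ?ltW// pnatr_eq0 -lt0n.
by rewrite ge0_ler_powR ?nnegrE ?invr_ge0 ?walk_prob_ge0 ?exprn_ge0// ltW.
Qed.

End Schreier.

(** * Groups with a hyperbolic word length *)

Local Open Scope nat_scope.

(** What the geometric arguments use of a word length: the left-invariant
   metric it defines has finite balls and is geodesic on group elements. *)
Record word_length (G : groupType) (len : G -> nat) : Prop := WordLength {
  len1 : len 1%g = 0;
  lenV : forall g, len g^-1%g = len g;
  lenM : forall g h, len (g * h)%g <= len g + len h;
  len_ball : forall n, exists s : seq G, forall g, len g <= n -> g \in s;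
  len_split : forall g i, i <= len g ->
    exists a b, [/\ g = (a * b)%g, len a = i & len b = len g - i] }.

Section Length.
Variables (G : groupType) (len : G -> nat).
Hypothesis wl : word_length len.
Implicit Types g h p u v w x y z : G.

Definition ldist (g h : G) : nat := len ((g^-1 : G) * h)%g.
Local Notation d := ldist.

(** Twice the Gromov product of [x] and [y] at [w]; the factor 2 keeps it an
   integer. *)
Definition gprod (w x y : G) : nat := d w x + d w y - d x y.

Lemma ldist_sym x y : d x y = d y x.
Proof. by rewrite /d -(lenV wl) invgM invgK. Qed.

Lemma ldist_tri x y z : d x z <= d x y + d y z.
Proof.
rewrite /d (_ : x^-1 * z = (x^-1 * y) * (y^-1 * z))%g ?(lenM wl)//.
by rewrite -mulgA mulVKg.
Qed.

Lemma ldistM g x y : d (g * x)%g (g * y)%g = d x y.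
Proof. by rewrite /d invgM -!mulgA mulKg. Qed.

Lemma ldist1 x : d 1%g x = len x.
Proof. by rewrite /d invg1 mul1g. Qed.

Lemma ldistxx x : d x x = 0.
Proof. by rewrite /d mulVg (len1 wl). Qed.

Lemma ldistMr x y : d x (x * y)%g = len y.
Proof. by rewrite /d mulKg. Qed.

(** Gromov's four-point form of hyperbolicity. *)
Definition four_point (k : nat) := forall x y z w : G,
  d x z + d y w <= maxn (d x y + d z w) (d x w + d y z) + k.

Lemma gprodC w x y : gprod w x y = gprod w y x.
Proof. by rewrite /gprod addnC (ldist_sym x y). Qed.

Lemma gprodM g w x y : gprod (g * w)%g (g * x)%g (g * y)%g = gprod w x y.
Proof. by rewrite /gprod !ldistM. Qed.

Lemma gprodE w x y : gprod w x y + d x y = d w x + d w y.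
Proof. by have := ldist_tri x w y; rewrite /gprod (ldist_sym x w); lia. Qed.

Variable k : nat.
Hypothesis hyp : four_point k.

(** The ultrametric-like form of the four-point inequality, on which all later
   estimates rest. *)
Lemma gprod_min w x y z : minn (gprod w x y) (gprod w y z) <= gprod w x z + k.
Proof.
have := hyp x y z w; have := gprodE w x y; have := gprodE w y z; have := gprodE w x z.
by rewrite !(ldist_sym _ w); lia.
Qed.

(** A coarse version of having three points at infinity. *)
Definition tripod c L := exists w : 'I_3 -> G,
  (forall i, L <= len (w i)) /\ (forall i j, i != j -> gprod 1%g (w i) (w j) <= c).

Lemma tripod_of c L x y z : L <= len x -> L <= len y -> L <= len z ->
  gprod 1%g x y <= c -> gprod 1%g x z <= c -> gprod 1%g y z <= c -> tripod c L.
Proof.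
move=> Lx Ly Lz xy xz yz; exists (fun i : 'I_3 => tnth [tuple x; y; z] i); split.
  by case=> [[|[|[|//]]] ?].
by case=> [[|[|[|//]]] ?] [[|[|[|//]]] ?]//= _; rewrite // gprodC.
Qed.

(** The powers of an element that does not backtrack ([gprod 1 g g^-1] small)
   go along a quasi-geodesic: by induction they keep away from the direction of
   [g^-1], so each further factor adds nearly [len g].  The bound [3 * k] is the
   one that [loxodromic_element] achieves; [10 * k] exceeds all error terms. *)
Lemma gprod_pow g n : gprod 1%g g g^-1%g <= 3 * k -> 10 * k < len g ->
  gprod 1%g g^-1%g (g ^+ n)%g <= 4 * k /\
  len (g ^+ n.+1)%g + 4 * k >= len g + len (g ^+ n)%g.
Proof.
move=> gg lg.
have step m : gprod 1%g g^-1%g (g ^+ m)%g <= 4 * k ->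
    len (g ^+ m.+1)%g + 4 * k >= len g + len (g ^+ m)%g.
  move=> h; have := gprodE 1%g g^-1%g (g ^+ m)%g.
  have -> : d g^-1%g (g ^+ m)%g = len (g ^+ m.+1)%g by rewrite /d invgK -expgS.
  by rewrite !ldist1 (lenV wl); lia.
elim: n => [|n [IH1 IH2]].
  have h : gprod 1%g g^-1%g (g ^+ 0)%g <= 4 * k.
    by rewrite expg0 gprodC /gprod ldistxx subnn.
  by split => //; apply: step.
suff h : gprod 1%g g^-1%g (g ^+ n.+1)%g <= 4 * k by split => //; apply: step.
have := gprodE 1%g g (g ^+ n.+1)%g.
have -> : d g (g ^+ n.+1)%g = len (g ^+ n)%g by rewrite /d expgS mulKg.
rewrite !ldist1; have := gprod_min 1%g g^-1%g (g ^+ n.+1)%g g.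
by rewrite (gprodC _ _ g) (gprodC _ g^-1%g g); lia.
Qed.

Lemma len_pow g n : gprod 1%g g g^-1%g <= 3 * k -> 10 * k < len g ->
  n <= len (g ^+ n)%g.
Proof.
move=> gg lg; elim: n => [//|n IH].
by have [_] := gprod_pow n gg lg; lia.
Qed.

(** All powers of [g] leave the identity in the direction of [g]. *)
Lemma gprod_pow_dir g n : gprod 1%g g g^-1%g <= 3 * k -> 10 * k < len g ->
  2 * len g <= gprod 1%g g (g ^+ n.+1)%g + 4 * k.
Proof.
move=> gg lg; have [_] := gprod_pow n gg lg; have := gprodE 1%g g (g ^+ n.+1)%g.
have -> : d g (g ^+ n.+1)%g = len (g ^+ n)%g by rewrite /d expgS mulKg.
by rewrite !ldist1; lia.
Qed.

Lemma finite_index_cobounded (H : set G) D : subgroup H ->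
  (forall p, exists2 h, H h & d h p <= D) -> finite_index H.
Proof.
move=> [_ HV] cob; have [s sP] := len_ball wl D.
have HD x y : H x -> H y -> H (x * y^-1)%g.
  by move=> Hx Hy; apply/set_mem/HV; apply/mem_set.
apply: (@sub_finite_set _ _ (rcos H @` [set` s])); last exact: finite_image.
move=> _ [p _ <-]; have [h Hh hp] := cob p; exists (h^-1 * p)%g; first exact: sP.
apply/seteqP; split => [_ [x Hx <-]|_ [x Hx <-]].
  by exists (x * h^-1)%g; rewrite ?mulgA//; apply: HD.
exists (x * h)%g; last by rewrite mulgA mulgK.
rewrite -[h]invgK; apply: (HD) => //; rewrite -[h^-1%g]mul1g; apply: (HD) => //.
by rewrite -(mulgV h); apply: HD.
Qed.

Lemma cyclic_subgroupP (g : G) : subgroup (cyclic_subgroup g).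
Proof.
split; first by apply/mem_set; exists 0; left.
have D n m : cyclic_subgroup g (g ^+ n / g ^+ m)%g.
  have [mn|/ltnW nm] := leqP m n; first by exists (n - m); left; rewrite expgnFr.
  by exists (m - n); right; rewrite expgnFr// invgF.
have DV n m : cyclic_subgroup g (g ^- n * g ^+ m)%g.
  have [nm|/ltnW mn] := leqP n m.
    by exists (m - n); left; rewrite -{1}(subnKC nm) expgnDr mulKg.
  by exists (n - m); right; rewrite -{1}(subnKC mn) expgnDr invgM mulgVK.
move=> x y /set_mem[n [->|->]] /set_mem[m [->|->]]; apply/mem_set.
- exact: D.
- by exists (n + m); left; rewrite invgK expgnDr.
- by exists (m + n); right; rewrite -invgM expgnDr.
- by rewrite invgK.
Qed.

(** The two halves of a geodesic, seen from its midpoint. *)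
Lemma antipodal N : (forall D, exists g, D <= len g) ->
  exists x y, [/\ len x = N, len y = N & gprod 1%g x y = 0].
Proof.
move=> unb; have [g Ng] := unb (2 * N).
have [e [e' [_ le _]]] := len_split wl Ng.
have Ne : N <= len e by lia.
have [a [b [eE la lb]]] := len_split wl Ne.
exists a^-1%g, b; rewrite /gprod !ldist1 /d !invgK -eE (lenV wl).
by split; lia.
Qed.

(** Take antipodal points [x] and [y] of a long geodesic.  Without tripods,
   [x^-1] and [y^-1] point towards [x] or [y].  If [x^-1] points towards [y], then
   [x] does not backtrack; likewise for [y].  Otherwise [x y] works: it starts
   along [x] and its inverse starts along [y^-1], which is the direction of [y]. *)
Lemma loxodromic_element : (forall D, exists g, D <= len g) -> (forall c, exists L, ~ tripod c L) ->
  exists2 g, gprod 1%g g g^-1%g <= 3 * k & 10 * k < len g.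
Proof.
move=> unb notri; have [L noL] := notri k.
have [x [y [lx ly xy]]] := antipodal (L + 10 * k + 1) unb.
have near p : L <= len p -> k < gprod 1%g p x \/ k < gprod 1%g p y.
  move=> Lp; have [px|?] := leqP (gprod 1%g p x) k; last by left.
  right; rewrite ltnNge; apply/negP => py; apply: noL.
  by apply: (@tripod_of _ _ p x y) => //; lia.
have m3 u v w : minn (gprod 1%g u v) (gprod 1%g v w) <= gprod 1%g u w + k.
  exact: gprod_min.
have S u v : gprod 1%g u v = gprod 1%g v u by exact: gprodC.
have [] := near x^-1%g; first by rewrite (lenV wl); lia.
  move=> xx; have [] := near y^-1%g; first by rewrite (lenV wl); lia.
    move=> yx; exists y; last lia.
    by have := m3 x y^-1%g y; rewrite (S x y^-1%g) (S y^-1%g y); lia.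
  move=> yy.
  have xVy : gprod 1%g x^-1%g y <= k.
    by have := m3 x x^-1%g y; rewrite (S x x^-1%g); lia.
  have yVx : gprod 1%g x y^-1%g <= k.
    by have := m3 x y^-1%g y; lia.
  have lxy : 2 * (L + 10 * k + 1) <= len (x * y)%g + k.
    have := gprodE 1%g x^-1%g y; rewrite !ldist1 (lenV wl) /d invgK; lia.
  have p1 : gprod 1%g x (x * y)%g = len (x * y)%g.
    by rewrite /gprod !ldist1 ldistMr; lia.
  have p2 : gprod 1%g y^-1%g (x * y)^-1%g = len (x * y)%g.
    have e : d y^-1%g (x * y)^-1%g = len x by rewrite /d invgK invgM mulVKg (lenV wl).
    by rewrite /gprod e !ldist1 !(lenV wl); lia.
  exists (x * y)%g; last lia.
  have := m3 x (x * y)^-1%g y^-1%g; rewrite (S _ y^-1%g) p2.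
  by have := m3 x (x * y)%g (x * y)^-1%g; rewrite p1; lia.
move=> xy'; exists x; last lia.
by have := m3 x x^-1%g y; lia.
Qed.

(** Without tripods, either the group is finite or it has an element [g] whose
   powers are quasi-geodesic.  An element [p] far from all powers of [g] would
   form, with [g ^+ m] and [g ^- m] seen from the power nearest to [p], a tripod
   with long arms.  So [G] is within bounded distance of the cyclic group of [g]. *)
Lemma virtually_cyclic_of_no_tripod : (forall c, exists L, ~ tripod c L) -> virtually_cyclic G.
Proof.
move=> notri; have [unb|/existsNP[D bdd]] := pselect (forall D, exists g, D <= len g); last first.
  exists 1%g; apply: (@finite_index_cobounded _ D); first exact: cyclic_subgroupP.
  move=> p; exists 1%g; first by exists 0; left.
  rewrite ldist1 leqNgt; apply/negP => Dp; apply: bdd; exists p; lia.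
have [g gg lg] := loxodromic_element unb notri; exists g.
have gV : gprod 1%g g^-1%g (g^-1)^-1%g <= 3 * k by rewrite invgK gprodC.
have lV : 10 * k < len g^-1%g by rewrite (lenV wl).
have [L noL] := notri (len g + 6 * k).
apply: (@finite_index_cobounded _ L); first exact: cyclic_subgroupP.
(* By left translation, the point of the cyclic subgroup nearest to p may be
   taken to be the identity; a tripod with arms towards p and both ends of the
   powers of g then bounds len p. *)
suff near p : (forall h, cyclic_subgroup g h -> len p <= d h p) -> len p <= L.
  move=> p; pose P n := `[< exists2 h, cyclic_subgroup g h & d h p = n >].
  have exP : exists n, P n by exists (d 1%g p); apply/asboolP; exists 1%g => //; exists 0; left.
  case: (ex_minnP exP) => n /asboolP[h gh hp] nmin; exists h => //.
  rewrite /d; apply: near => h' gh'.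
  rewrite -(ldistM h h') mulVKg -/(d h p) hp; apply: nmin.
  apply/asboolP; exists (h * h')%g => //.
  have [one dv] := cyclic_subgroupP g; apply/set_mem; rewrite -[h']invgK.
  apply: (dv); first exact/mem_set.
  by rewrite -[h'^-1%g]mul1g; apply: dv => //; apply/mem_set.
move=> pmin; rewrite leqNgt; apply/negP => Lp; apply: noL.
pose n := L; have gn : cyclic_subgroup g g by exists 1; left.
have gVn : cyclic_subgroup g g^-1%g by exists 1; right.
have D1 := gprod_pow_dir n gg lg; have D2 := gprod_pow_dir n gV lV.
have L1 := len_pow n.+1 gg lg; have L2 := len_pow n.+1 gV lV.
rewrite (lenV wl) in D2.
have P1 := pmin _ gn; have P2 := pmin _ gVn.
have E1 := gprodE 1%g p g; have E2 := gprodE 1%g p g^-1%g.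
rewrite !ldist1 (ldist_sym p) in E1; rewrite !ldist1 (ldist_sym p) (lenV wl) in E2.
set u := (g ^+ n.+1)%g in D1 L1 *; set v := (g^-1 ^+ n.+1)%g in D2 L2 *.
apply: (@tripod_of _ _ p u v); rewrite ?/n; [lia|lia|lia| | |].
- by have := gprod_min 1%g p u g; rewrite (gprodC _ u); lia.
- by have := gprod_min 1%g p v g^-1%g; rewrite (gprodC _ v); lia.
- have := gprod_min 1%g g u v; rewrite (gprodC _ g u).
  have := gprod_min 1%g g v g^-1%g; rewrite (gprodC _ v).
  have := gprod_min 1%g u g v; rewrite (gprodC _ u g).
  lia.
Qed.

End Length.

(** * Trees of words avoiding a direction *)

Section Tree.
Variables (G : groupType) (len : G -> nat) (k : nat).
Hypothesis wl : word_length len.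
Hypothesis hyp : four_point len k.
Implicit Types g h p u v w x y z : G.
Local Notation d := (ldist len).
Local Notation gp := (gprod len 1%g).

(** All of [Z] is seen from the identity in one and the same direction. *)
Definition coherent c (Z : set G) := forall z z', Z z -> Z z' -> c < gp z z'.

(** Two arms both close to the direction of [Z] would be close to each other. *)
Lemma tripod_avoid c (w : 'I_3 -> G) (Z : set G) :
  (forall i j, i != j -> gp (w i) (w j) <= c) -> coherent (c + 2 * k) Z ->
  exists i j, i != j /\ forall z, Z z -> gp z (w i) <= c + 2 * k /\ gp z (w j) <= c + 2 * k.
Proof.
move=> wc Zc; pose bad i := exists2 z, Z z & c + 2 * k < gp z (w i).
have good i : ~ bad i -> forall z, Z z -> gp z (w i) <= c + 2 * k.
  by move=> nb z Zz; rewrite leqNgt; apply/negP => b; apply: nb; exists z.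
have two i j : i != j -> ~ (bad i /\ bad j).
  move=> ij [[z Zz zi] [z' Zz' zj]]; have := wc i j ij; have := Zc z z' Zz Zz'.
  have := gprod_min wl hyp 1%g (w i) z z'; rewrite (gprodC wl _ (w i)).
  by have := gprod_min wl hyp 1%g (w i) z' (w j); lia.
pose a0 : 'I_3 := ord0; pose a1 : 'I_3 := inord 1; pose a2 : 'I_3 := inord 2.
have n01 : a0 != a1 by rewrite -val_eqE /= inordK.
have n02 : a0 != a2 by rewrite -val_eqE /= inordK.
have n12 : a1 != a2 by rewrite -val_eqE /= !inordK.
have pair i j : i != j -> ~ bad i -> ~ bad j -> exists i j, i != j /\
    forall z, Z z -> gp z (w i) <= c + 2 * k /\ gp z (w j) <= c + 2 * k.
  by move=> ij bi bj; exists i, j; split => // z Zz; split; apply: good.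
have [b0|b0] := pselect (bad a0).
  apply: (pair a1 a2) => // b; [exact: (two a0 a1)|exact: (two a0 a2)].
have [b1|b1] := pselect (bad a1); last exact: (pair a0 a1).
by apply: (pair a0 a2) => // b; apply: (two a1 a2).
Qed.

(** At each vertex two arms of the tripod lead away from the direction to
   avoid: at the root that is [Z], afterwards it is the way back.  Because the
   arms are long, a word that does not turn back keeps the direction of its first
   arm, so the constants do not deteriorate with [m] and the words that
   separate at some vertex are different elements.  The bound [c + 3 * k] is the
   one that reproduces itself in the induction; arms more than twice as long
   outweigh it. *)
Lemma binary_tree c : tripod len c (2 * (c + 3 * k) + 1) ->
  exists K, forall m (Z : set G), coherent (c + 2 * k) Z ->
    exists T : seq G, [/\ uniq T, size T = 2 ^ m &
      forall v, v \in T -> len v <= m * K /\ forall z, Z z -> gp z v <= c + 3 * k].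
Proof.
move=> [w [wL wc]]; exists (\max_(i < 3) len (w i)).
set K := \max_(_ < _) _; have wK i : len (w i) <= K by rewrite /K leq_bigmax.
elim=> [|m IH] Z Zc.
  exists [:: 1%g]; split => // v; rewrite inE => /eqP ->; split.
    by rewrite (len1 wl).
  by move=> z _; have := gprodE wl 1%g z 1%g; rewrite (ldistxx wl) (ldist_sym wl z); lia.
have [i [j [ij Zij]]] := tripod_avoid wc Zc.
(* Seen from w n, the direction to avoid is that of 1, i.e. (w n)^-1. *)
have sub n : exists T : seq G, [/\ uniq T, size T = 2 ^ m &
    forall v, v \in T -> len v <= m * K /\ gp (w n)^-1%g v <= c + 3 * k].
  have [|T [uT sT TP]] := IH [set (w n)^-1%g].
    move=> _ _ -> ->; have := wL n; rewrite /gprod (ldistxx wl) !ldist1 (lenV wl); lia.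
  by exists T; split => // v /TP[lv gv]; split => //; apply: gv.
have dir n v : gp (w n)^-1%g v <= c + 3 * k ->
    c + 3 * k + k + c < gp (w n) (w n * v)%g.
  have e : d (w n)^-1%g v = len (w n * v)%g by rewrite /ldist invgK.
  have := gprodE wl 1%g (w n)^-1%g v; rewrite e !ldist1 (lenV wl).
  have := gprodE wl 1%g (w n) (w n * v)%g; rewrite (ldistMr) !ldist1; have := wL n.
  lia.
have [Ti [uTi sTi TiP]] := sub i; have [Tj [uTj sTj TjP]] := sub j.
exists ([seq (w i * v)%g | v <- Ti] ++ [seq (w j * v)%g | v <- Tj]); split.
- rewrite cat_uniq !map_inj_uniq ?uTi ?uTj ?andbT/=; try exact: mulgI.
  apply/hasPn => _ /mapP[v /TjP[_ vj] ->]; apply/negP => /mapP[v' /TiP[_ vi] e].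
  have := dir j v vj; have := dir i v' vi; rewrite -e.
  have := gprod_min wl hyp 1%g (w i) (w j * v)%g (w j).
  by have := wc i j ij; rewrite (gprodC wl 1%g (w j * v)%g); lia.
- by rewrite size_cat !size_map sTi sTj addnn expnS mul2n.
have fin n v : len v <= m * K -> gp (w n)^-1%g v <= c + 3 * k ->
    (forall z, Z z -> gp z (w n) <= c + 2 * k) ->
    len (w n * v)%g <= m.+1 * K /\ forall z, Z z -> gp z (w n * v)%g <= c + 3 * k.
  move=> lv vn Zn; split.
    by have := lenM wl (w n) v; have := wK n; lia.
  move=> z Zz; have := Zn z Zz; have := dir n v vn.
  have := gprod_min wl hyp 1%g z (w n * v)%g (w n).
  by rewrite (gprodC wl 1%g (w n * v)%g); lia.
move=> u; rewrite mem_cat => /orP[] /mapP[v vT ->].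
  by have [lv gv] := TiP v vT; apply: fin => // z /Zij[].
by have [lv gv] := TjP v vT; apply: fin => // z /Zij[].
Qed.

End Tree.

(** * Distance to a quasiconvex subgroup *)

Section Subgroup.
Variables (G : groupType) (len : G -> nat) (k : nat).
Hypothesis wl : word_length len.
Hypothesis hyp : four_point len k.
Implicit Types g h p u v w x y z : G.
Local Notation d := (ldist len).
Local Notation gp := (gprod len).
Variable H : set G.
Hypothesis HP : subgroup H.
Implicit Types C : coset_type H.

Lemma coset_len_exists C : exists n, `[< exists2 x, val C x & len x = n >].
Proof.
have [g ->] := coset_eltP C; exists (len g); apply/asboolP; exists g => //=.
by have [H1 _] := HP; exists 1%g; rewrite ?mul1g//; apply/set_mem.
Qed.

(** For [C = H g] this is the distance from [g] to [H]. *)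
Definition coset_len C := ex_minn (coset_len_exists C).

Lemma coset_len_le g h : H h -> coset_len (coset_elt H g) <= d h g.
Proof.
move=> Hh; rewrite /coset_len; case: ex_minnP => n _; apply; apply/asboolP.
exists (h^-1 * g)%g => //; exists (h^-1)%g => //.
have [H1 Hd] := HP; rewrite -[h^-1%g]mul1g; apply/set_mem/Hd => //; exact/mem_set.
Qed.

Lemma coset_len_attained g : exists2 h, H h & d h g = coset_len (coset_elt H g).
Proof.
rewrite /coset_len; case: ex_minnP => n /asboolP[_ [h Hh <-] <-] _.
exists h^-1%g; last by rewrite /ldist invgK.
have [H1 Hd] := HP; rewrite -[h^-1%g]mul1g; apply/set_mem/Hd => //; exact/mem_set.
Qed.

Lemma coset_len_rep C : exists2 g, C = coset_elt H g & len g = coset_len C.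
Proof.
have [g ->] := coset_eltP C; have [h Hh e] := coset_len_attained g.
exists (h^-1 * g)%g => //; apply: val_inj; apply/seteqP => /=.
have [H1 Hd] := HP; split => [_ [x Hx <-]|_ [x Hx <-]].
  exists (x * h)%g; last by rewrite mulgA mulgK.
  rewrite -[h]invgK; apply/set_mem/Hd; first exact/mem_set.
  by rewrite -[h^-1%g]mul1g; apply: (Hd) => //; exact/mem_set.
exists (x * h^-1)%g; last by rewrite mulgA.
by apply/set_mem/Hd; apply/mem_set.
Qed.

(** Otherwise [H] would be cobounded, and cobounded subgroups have finite index
   because balls are finite. *)
Lemma far_coset D : ~ finite_index H -> exists u, D <= coset_len (coset_elt H u).
Proof.
move=> inf; apply: contrapT => /forallNP near; apply: inf.
apply: (finite_index_cobounded wl (D := D)) => // p.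
have [h Hh e] := coset_len_attained p; exists h => //.
by have := near p; rewrite e; lia.
Qed.

Variable e : nat.
Hypothesis qc : forall h h' q, H h -> H h' -> d h q + d q h' = d h h' ->
  coset_len (coset_elt H q) <= e.

Definition coherence_defect := 2 * k + 2 * e + 2.

(** The point [q] of a geodesic from [h] to [h'] where the sides of the triangle
   with apex [g] part is at distance about the Gromov product from [g], and it is
   close to [H] by quasiconvexity. *)
Lemma subgroup_coherent g h h' : H h -> H h' ->
  2 * coset_len (coset_elt H g) <= gp g h h' + coherence_defect.
Proof.
(* The distance from h to the point q: the Gromov product (g | h')_h, rounded
   down. *)
move=> Hh Hh'; pose t := (d g h + d h h' - d g h')./2.
have th : t <= d h h'.
  have := ldist_tri wl g h' h; rewrite (ldist_sym wl h' h) /t; lia.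
have [a [b [ab la lb]]] := len_split wl (th : t <= len (h^-1 * h')%g).
pose q := (h * a)%g; have hq : d h q = t by rewrite /q ldistMr.
have qh' : d q h' = d h h' - t.
  have e1 : h' = (h * a * b)%g by rewrite -mulgA -ab mulVKg.
  by rewrite {1}e1 /q ldistMr lb.
have qe : coset_len (coset_elt H q) <= e by apply: (qc Hh Hh'); rewrite hq qh' subnKC.
have [x Hx xq] := coset_len_attained q.
have := coset_len_le g Hx; have := ldist_tri wl x q g.
have := hyp g h q h'; have := gprodE wl g h h'.
rewrite qh' (ldist_sym wl g q) /coherence_defect hq.
have := ldist_tri wl g h h'; have := ldist_tri wl h g h'; have := ldist_tri wl g h' h.
rewrite (ldist_sym wl h g) (ldist_sym wl h' h) /t; lia.
Qed.

(** From a coset far from [H], the tree avoiding the common direction of [H]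
   consists of outward steps.  From a coset near [H], first go to the fixed far
   coset of [u]: this costs a bounded amount, which [c0] and [B] absorb.  It is
   essential that [c0] does not depend on the depth [m]. *)
Lemma outward_steps c : ~ finite_index H -> tripod len c (2 * (c + 3 * k) + 1) ->
  exists c0 K B, forall m C, exists T : seq G, [/\ uniq T, size T = 2 ^ m &
    forall v, v \in T -> len v <= m * K + B /\
      coset_len C + len v <= coset_len (coset_mul C v) + c0].
Proof.
move=> inf tri; have [K tree] := binary_tree wl hyp tri.
pose D := coherence_defect + c + 2 * k + 1; pose c2 := c + 3 * k.
have far m g : D <= coset_len (coset_elt H g) ->
    exists T : seq G, [/\ uniq T, size T = 2 ^ m &
    forall v, v \in T -> len v <= m * K /\
      coset_len (coset_elt H g) + len v <= coset_len (coset_elt H (g * v)%g) + c2].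
  move=> gD; have [|T [uT sT TP]] := tree m [set (g^-1 * h)%g | h in H].
    move=> _ _ [h Hh <-] [h' Hh' <-]; have := subgroup_coherent g Hh Hh'.
    have -> : gp 1%g (g^-1 * h)%g (g^-1 * h')%g = gp g h h'.
      by rewrite -(gprodM len g 1%g) mulg1 !mulVKg.
    by rewrite /D in gD; lia.
  exists T; split => // v /TP[lv Tv]; split => //.
  have [h Hh e2] := coset_len_attained (g * v)%g.
  have := coset_len_le g Hh; have := Tv (g^-1 * h)%g (ex_intro2 _ _ h Hh erefl).
  have := gprodE wl 1%g (g^-1 * h)%g v; rewrite !ldist1.
  have -> : len (g^-1 * h)%g = d h g by rewrite (ldist_sym wl).
  have -> : d (g^-1 * h)%g v = d h (g * v)%g by rewrite -(ldistM len g) mulVKg.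
  by rewrite -e2 /c2; lia.
have [u uD] := far_coset D inf.
exists (c2 + D + len u), K, (D + len u) => m C.
have [g -> lg] := coset_len_rep C.
have [gD|/ltnW gD] := leqP D (coset_len (coset_elt H g)).
  have [T [uT sT TP]] := far m g gD; exists T; split => // v /TP[lv ev].
  by rewrite coset_elt_mul; lia.
have [T [uT sT TP]] := far m u uD.
pose w : G := (g^-1 * u)%g; have gw : (g * w)%g = u by rewrite mulVKg.
have lw : len w <= len g + len u by rewrite -(lenV wl g) (lenM wl).
exists [seq (w * v)%g | v <- T]; split.
- by rewrite map_inj_uniq//; apply: mulgI.
- by rewrite size_map.
move=> _ /mapP[v /TP[lv ev] ->]; have := lenM wl w v.
have -> : coset_mul (coset_elt H g) (w * v)%g = coset_elt H (u * v)%g.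
  by rewrite coset_elt_mul mulgA gw.
by move: (w * v)%g => wv; lia.
Qed.

(** The point [g v^-1] is nearly on a geodesic from [g] to its projection [p] on
   [H], at distance [len v] from [g]; two points at the same height of such a
   geodesic are close to each other.  So each length contributes at most the
   size of a ball whose radius is independent of [K]. *)
Lemma inward_steps c0 : exists M, forall K (T : seq G) C, uniq T ->
  (forall v, v \in T -> len v <= K) ->
  count (fun v => coset_len (coset_mul C v^-1%g) + len v <= coset_len C + c0) T <= M * K.+1.
Proof.
have [s sP] := len_ball wl (2 * c0 + coherence_defect + k).
exists (size s) => K T C uT TK; have [g -> _] := coset_len_rep C.
set P := fun v => _; have [p Hp pg] := coset_len_attained g.
have near v : P v -> d p (g * v^-1)%g + len v <= d p g + (2 * c0 + coherence_defect).
  rewrite /P coset_elt_mul; have [h Hh e2] := coset_len_attained (g * v^-1)%g.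
  have := subgroup_coherent g Hh Hp; have := gprodE wl g h p.
  have := ldist_tri wl h (g * v^-1)%g g; have := ldist_tri wl p h (g * v^-1)%g.
  have -> : d (g * v^-1)%g g = len v by rewrite (ldist_sym wl) ldistMr (lenV wl).
  by rewrite (ldist_sym wl g h) (ldist_sym wl g p) (ldist_sym wl p h) pg e2; lia.
have same j : count (fun v => P v && (len v == j)) T <= size s.
  rewrite -size_filter; set r := seq.filter _ T; case rE: r => [//|v0 r0].
  rewrite -rE -(size_map (fun b => (b * v0)%g) s).
  apply: uniq_leq_size; first exact: filter_uniq.
  move=> v; rewrite mem_filter => /andP[/andP[Pv /eqP lv] _].
  have : v0 \in r by rewrite rE mem_head.
  rewrite mem_filter => /andP[/andP[Pv0 /eqP lv0] _].
  apply/mapP; exists (v * v0^-1)%g; last by rewrite mulgVK.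
  apply: sP; have -> : len (v * v0^-1)%g = d (g * v^-1)%g (g * v0^-1)%g.
    by rewrite ldistM /ldist invgK.
  have := hyp (g * v^-1)%g p (g * v0^-1)%g g.
  have := near v Pv; have := near v0 Pv0.
  have e3 w : d (g * w^-1)%g g = len w by rewrite (ldist_sym wl) ldistMr (lenV wl).
  by rewrite !e3 lv lv0 (ldist_sym wl (g * v^-1)%g p); lia.
have cntE n : count (fun v => P v && (len v < n)) T <= size s * n.
  elim: n => [|n IH].
    by rewrite (eq_count (a2 := pred0)) ?count_pred0// => v /=; rewrite andbF.
  apply: (@leq_trans (count (fun v => P v && (len v < n)) T + count (fun v => P v && (len v == n)) T)).
    rewrite -count_predUI; apply: leq_trans (leq_addr _ _); apply: sub_count => v /=.
    by case: (P v) => //=; rewrite ltnS leq_eqVlt orbC.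
  by rewrite mulnS addnC leq_add.
rewrite (eq_in_count (a2 := fun v => P v && (len v < K.+1))) => [|v /TK vK]; first exact: cntE.
by rewrite ltnS vK andbT.
Qed.

Lemma exp_beats_linear a b : exists m, a * m + b <= 2 ^ m.
Proof.
pose n := 2 * a + b; exists (2 * n); rewrite mul2n -addnn expnD.
have := ltn_expl n (isT : 1 < 2); rewrite /n; set q := 2 ^ _ => h.
apply: (@leq_trans ((n.+1) * n.+1)); first by rewrite /n; nia.
by rewrite leq_mul.
Qed.

(** Exponentially many outward steps against linearly many inward ones. *)
Lemma coset_expansion c : ~ finite_index H -> tripod len c (2 * (c + 3 * k) + 1) ->
  exists (T : seq G) (E : coset_type H -> G -> bool) (N M : nat),
    [/\ 0 < N, 4 * M <= N, forall C, N <= count (E C) T &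
        forall C, count (fun v => E (coset_mul C v^-1%g) v) T <= M].
Proof.
move=> inf tri; have [c0 [K [B out]]] := outward_steps inf tri.
have [M inn] := inward_steps c0.
have [m mP] := exp_beats_linear (4 * M * K) (4 * M * B.+1).
have [s sP] := len_ball wl (m * K + B).
pose T := undup [seq g <- s | len g <= m * K + B].
have TP g : (g \in T) = (len g <= m * K + B).
  by rewrite mem_undup mem_filter; apply: andb_idr; apply: sP.
exists T, (fun C v => coset_len C + len v <= coset_len (coset_mul C v) + c0), (2 ^ m), (M * (m * K + B).+1).
split.
- by rewrite expn_gt0.
- by apply: leq_trans mP; nia.
- move=> C; have [S [uS <- SP]] := out m C; rewrite -size_filter.
  apply: uniq_leq_size => // v /SP[lv ev]; rewrite mem_filter ev TP//.
- move=> C; under eq_count do rewrite coset_mulM mulVg coset_mul1.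
  by apply: inn => [|v]; [exact: undup_uniq|rewrite TP].
Qed.

End Subgroup.

Local Open Scope ring_scope.

(** * Graphs and their geometric realizations *)

Section Graph.
Variable X : graph.
Implicit Types x y z u v : vertex X.

Definition adjacent x y := exists2 d : dart X, dsrc d = x & dtgt d = y.

Lemma adjacentC x y : adjacent x y -> adjacent y x.
Proof. by case=> -[e b] sx ty; exists (e, ~~ b); rewrite -?sx -?ty; case: b {sx ty}. Qed.

Lemma walk_cat m n x y z : walk m x y -> walk n y z -> walk (m + n) x z.
Proof.
elim: m x => [x -> //|m IH x [d dx wy] wz]; exists d => //; exact: IH.
Qed.

Lemma walk_adjacent x y : adjacent x y -> walk 1 x y.
Proof. by case=> d dx dy; exists d. Qed.

Lemma walk_sym n x y : walk n x y -> walk n y x.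
Proof.
elim: n x => [x //|n IH x [d dx wy]]; rewrite -addn1; apply: walk_cat (IH _ wy) _.
by apply/walk_adjacent/adjacentC; exists d.
Qed.

Definition trace n (s : nat -> vertex X) := forall i, (i < n)%N -> adjacent (s i) (s i.+1).

Lemma trace_of_walk n x y : walk n x y -> exists s, [/\ s 0%N = x, s n = y & trace n s].
Proof.
elim: n x => [x ->|n IH x [d dx /IH[s [s0 sn st]]]]; first by exists (fun=> y).
exists (fun i => if i is j.+1 then s j else x); split => // -[_|i].
  by exists d; rewrite ?s0.
exact: st.
Qed.

Lemma walk_of_trace n s i j : trace n s -> (i <= j <= n)%N -> walk (j - i) (s i) (s j).
Proof.
move=> st /andP[ij jn]; rewrite -{2}(subnKC ij); have: (i + (j - i) <= n)%N by rewrite subnKC.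
elim: (j - i)%N => [|m IH] h; first by rewrite addn0.
rewrite -[m.+1]addn1; apply: walk_cat; first by apply: IH; apply: leq_trans h; rewrite leq_add2l.
by apply: walk_adjacent; rewrite addn1 addnS; apply: st; rewrite -addnS.
Qed.

Hypothesis conn : forall x y, exists n, walk n x y.

Lemma vdist_exists x y : exists n, `[< walk n x y >].
Proof. by have [n w] := conn x y; exists n; apply/asboolP. Qed.

Definition vdist x y := ex_minn (vdist_exists x y).

Lemma vdist_walk x y : walk (vdist x y) x y.
Proof. by rewrite /vdist; case: ex_minnP => n /asboolP. Qed.

Lemma vdist_le n x y : walk n x y -> (vdist x y <= n)%N.
Proof. by move=> w; rewrite /vdist; case: ex_minnP => m _; apply; apply/asboolP. Qed.

Lemma vdistxx x : vdist x x = 0%N.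
Proof. by apply/eqP; rewrite -leqn0; apply: (@vdist_le 0). Qed.

Lemma vdist_sym x y : vdist x y = vdist y x.
Proof. by apply/eqP; rewrite eqn_leq !vdist_le//; apply: walk_sym; apply: vdist_walk. Qed.

Lemma vdist_tri x y z : (vdist x z <= vdist x y + vdist y z)%N.
Proof. by apply: vdist_le; apply: walk_cat; apply: vdist_walk. Qed.

Lemma vdist_adjacent u x y : adjacent x y -> (vdist u y <= vdist u x + 1)%N.
Proof.
move=> a; apply: leq_trans (vdist_tri u x y) _; rewrite leq_add2l.
by apply: vdist_le; apply: walk_adjacent.
Qed.

Definition between x y q := (vdist x q + vdist q y = vdist x y)%N.

(** A geodesic through [q] is obtained by concatenating one from [x] to [q] and
   one from [q] to [y]. *)
Lemma between_trace x y q : between x y q -> exists s,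
  [/\ s 0%N = x, s (vdist x y) = y, trace (vdist x y) s & s (vdist x q) = q].
Proof.
move=> xqy.
have [s [s0 sn st]] := trace_of_walk (vdist_walk x q).
have [s' [s'0 s'n s't]] := trace_of_walk (vdist_walk q y).
set a := vdist x q in sn st *.
exists (fun i => if (i <= a)%N then s i else s' (i - a)%N); rewrite -xqy -/a leqnn; split => //.
  case: leqP => [h|_]; last by rewrite addKn.
  have e : vdist q y = 0%N by lia.
  by rewrite e addn0 sn -s'0 -{1}e s'n.
move=> i ib; case: (ltnP i a) => [ia|ai]; first by rewrite (ltnW ia); apply: st.
rewrite subSn//.
have -> : (if (i <= a)%N then s i else s' (i - a)%N) = s' (i - a)%N.
  by case: leqP => // ia; rewrite (_ : i = a) ?sn ?subnn ?s'0//; lia.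
by apply: s't; rewrite ltn_subLR.
Qed.

Lemma geodesic_trace n s i : trace n s -> n = vdist (s 0%N) (s n) -> (i <= n)%N ->
  vdist (s 0%N) (s i) = i /\ between (s 0%N) (s n) (s i).
Proof.
move=> st nE lin.
have h1 : (vdist (s 0%N) (s i) <= i)%N.
  by apply: vdist_le; have := walk_of_trace (i := 0) (j := i) st; rewrite subn0; apply.
have h2 : (vdist (s i) (s n) <= n - i)%N.
  by apply: vdist_le; apply: (walk_of_trace st); rewrite lin leqnn.
have := vdist_tri (s 0%N) (s i) (s n); rewrite -nE /between => h3; split; lia.
Qed.

(** Thin triangles for vertices.  No sides are chosen: [between y z q'] says that
   [q'] lies on some geodesic from [y] to [z]. *)
Definition thin D := forall x y z q, between x y q ->
  exists2 q', (vdist q q' <= D)%N & between y z q' \/ between z x q'.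

Lemma between_le x y q p D : between x y q -> (vdist p q <= D)%N ->
  (vdist x p + vdist p y <= vdist x y + 2 * D)%N.
Proof.
rewrite /between => b pq; have := vdist_tri x q p; have := vdist_tri p q y.
by rewrite (vdist_sym q p); lia.
Qed.

(** Walking along a geodesic from [x] to [z], one passes from the vicinity of
   [[x, y]] to that of [[y, z]]; let [p] be a point near both.  In the triangle
   [x], [z], [w], the point [p] is also near [[z, w]] or [[w, x]].  In either case
   the detour through [p] of the two diagonals costs little more than a pair of
   opposite sides. *)
Lemma thin_four_point D : thin D -> forall x y z w,
  (vdist x z + vdist y w <=
   maxn (vdist x y + vdist z w) (vdist x w + vdist y z) + (4 * D + 2))%N.
Proof.
move=> thinD x y z w.
have [p [xzp [xy yz]]] : exists p, between x z p /\
    ((vdist x p + vdist p y <= vdist x y + 2 * D)%N /\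
     (vdist y p + vdist p z <= vdist y z + 2 * (D + 1))%N).
  have bx : between x z x by rewrite /between vdistxx.
  have [s [s0 sn st _]] := between_trace bx; set n := vdist x z in sn st.
  have nE : n = vdist (s 0%N) (s n) by rewrite s0 sn.
  have bt i : (i <= n)%N -> between x z (s i).
    by move=> lin; have [_] := geodesic_trace st nE lin; rewrite s0 sn.
  pose P i := `[< exists2 q, (vdist (s i) q <= D)%N & between x y q >] && (i <= n)%N.
  have P0 : exists i, P i.
    exists 0%N; rewrite /P andbT; apply/asboolP; exists x; first by rewrite s0 vdistxx.
    by rewrite /between vdistxx.
  have Pn i : P i -> (i <= n)%N by case/andP.
  case: (ex_maxnP P0 Pn) => i /andP[/asboolP[q iq xq] lin] imax.
  exists (s i); split; first exact: bt.
  split; first exact: between_le xq iq.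
  have {}lin : i = n \/ (i < n)%N by lia.
  case: lin => [->|lin].
    rewrite sn vdistxx; lia.
  have [q' iq' []] := thinD _ _ y _ (bt i.+1 lin); last first.
    move=> yx; have [] := negP (_ : ~~ P i.+1).
      by apply/negP => /imax; rewrite ltnn.
    apply/andP; split => //; apply/asboolP; exists q' => //.
    by move: yx; rewrite /between addnC (vdist_sym y x) (vdist_sym y q') (vdist_sym q' x).
  move=> zy; apply: (@between_le y z q' (s i)).
    by move: zy; rewrite /between addnC (vdist_sym z y) (vdist_sym z q') (vdist_sym q' y).
  have := vdist_tri (s i) (s i.+1) q'; have := vdist_adjacent (s i) (st i lin).
  by rewrite vdistxx; lia.
have [q pq []] := thinD _ _ w _ xzp.
  move=> zw; have := between_le zw pq; move: xzp xy yz; rewrite /between.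
  have := vdist_tri y p w; rewrite (vdist_sym p y) (vdist_sym z p); lia.
move=> wx; have := between_le wx pq; move: xzp xy yz; rewrite /between.
have := vdist_tri y p w; rewrite (vdist_sym p y) (vdist_sym w p) (vdist_sym p x) (vdist_sym w x).
lia.
Qed.

(** ** Geodesics of the realization *)

Variable R : realType.
Local Notation point := (gpoint R X).
Implicit Types p q : point.

(** The distance from the vertex [u], extended to the interior of edges. *)
Definition potential u p : R :=
  match p with
  | Vertex v => (vdist u v)%:R
  | Interior e t _ =>
      Num.min ((vdist u (src e))%:R + t) ((vdist u (tgt e))%:R + (1 - t))
  end.

Lemma adjacent_edge (e : edge X) : adjacent (src e) (tgt e).
Proof. by exists (e, true). Qed.

Lemma edge_lipschitz u (e : edge X) :
  ((vdist u (src e))%:R <= (vdist u (tgt e))%:R + 1 :> R) /\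
  ((vdist u (tgt e))%:R <= (vdist u (src e))%:R + 1 :> R).
Proof.
have ae := adjacent_edge e; have ea := adjacentC ae.
have := vdist_adjacent u ae; have := vdist_adjacent u ea.
by rewrite -!(natrD _ _ 1) !ler_nat.
Qed.

Lemma potential_exit u p v a : exits p (v, a) ->
  0 <= a /\ `|potential u p - (vdist u v)%:R| <= a.
Proof.
case: p => [w|e t /andP[t0 t1]] /=; first by case=> -> ->; rewrite subrr normr0.
have [st ts] := edge_lipschitz u e.
case=> -[-> ->]; split; rewrite ?ler_norml ?minEle; try lra.
  by case: ifPn; rewrite -?ltNge => ?; lra.
by case: ifPn; rewrite -?ltNge => ?; lra.
Qed.

Lemma vdist_lipschitz u v w n : walk n v w ->
  `|(vdist u v)%:R - (vdist u w)%:R| <= n%:R :> R.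
Proof.
move=> nw; have h1 := vdist_tri u v w; have h2 := vdist_tri u w v.
have := vdist_le nw; rewrite (vdist_sym w v) in h2 => h.
have {}h1 : (vdist u w)%:R <= (vdist u v)%:R + n%:R :> R by rewrite -natrD ler_nat; lia.
have {}h2 : (vdist u v)%:R <= (vdist u w)%:R + n%:R :> R by rewrite -natrD ler_nat; lia.
by rewrite ler_norml; lra.
Qed.

Lemma potential_lipschitz u p q l : path_length p q l ->
  `|potential u p - potential u q| <= l.
Proof.
case=> [[v [a [w [b [n [pv qw nw ->]]]]]]|].
  have [a0] := potential_exit u pv; have [b0] := potential_exit u qw.
  have := vdist_lipschitz u nw; rewrite !ler_norml; lra.
case: p => // e t t01; case: q => // e' t' t01' [<- ->] /=.
have := ler_norm (t - t'); have := ler_norm (t' - t); rewrite (distrC t').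
move=> h1 h2; rewrite ler_norml !minEle.
by case: ifPn; rewrite -?ltNge => ?; case: ifPn; rewrite -?ltNge => ?; lra.
Qed.

Lemma path_length_exists p q : path_length p q !=set0.
Proof.
have ex (r : point) : exists v a, exits r (v, a).
  case: r => [v|e t t01]; first by exists v, 0.
  by exists (src e), t; left.
have [v [a pv]] := ex p; have [w [b qw]] := ex q; have [n nw] := conn v w.
by exists (a + n%:R + b); left; exists v, a, w, b, n.
Qed.

(** Exits and walks change [potential u] by at most their length, so it is
   1-Lipschitz for [dist].  This is the source of all lower bounds on [dist]. *)
Lemma potential_le_dist u p q : `|potential u p - potential u q| <= dist p q.
Proof.
apply: lb_le_inf; first exact: path_length_exists.
by move=> l; apply: potential_lipschitz.
Qed.

Lemma dist_le_path p q l : path_length p q l -> dist p q <= l.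
Proof.
pose u := match p with Vertex v => v | Interior e _ _ => src e end.
by apply: ge_inf; exists 0 => m /(potential_lipschitz u); apply: le_trans.
Qed.

Lemma dist_sym p q : dist p q = dist q p.
Proof.
have sub (r r' : point) : path_length r r' `<=` path_length r' r.
  move=> l [[v [a [w [b [n [rv rw nw ->]]]]]]|seg]; [left|right].
    exists w, b, v, a, n; split => //; first exact: walk_sym.
    by ring.
  by move: seg; case: r => // e t t01; case: r' => // e' t' t01' [<- ->]; rewrite /= distrC.
by rewrite /dist; congr inf; apply/seteqP; split; apply: sub.
Qed.

(** The point at distance [r] from the origin of a dart, for [0 <= r < 1]; the
   fallback value is the right one for [r = 0]. *)
Definition dart_point (d : dart X) (r : R) : point :=
  match pselect (0 < r < 1), pselect (0 < 1 - r < 1) with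
  | left pf, left pf' => if d.2 then Interior d.1 r pf else Interior d.1 (1 - r) pf'
  | _, _ => Vertex (dsrc d)
  end.

Lemma dart_pointE d r : 0 < r < 1 -> exists pf pf',
  dart_point d r = if d.2 then Interior d.1 r pf else Interior d.1 (1 - r) pf'.
Proof.
move=> r01; have r01' : 0 < 1 - r < 1 by lra.
rewrite /dart_point; case: pselect => // pf; case: pselect => // pf'.
by exists pf, pf'.
Qed.

Lemma dart_point0 d : dart_point d 0 = Vertex (dsrc d).
Proof. by rewrite /dart_point; case: pselect => // pf; exfalso; move: pf; rewrite ltxx. Qed.

Lemma dart_point_src d r : 0 <= r < 1 -> exits (dart_point d r) (dsrc d, r).
Proof.
move=> /andP[]; rewrite le_eqVlt => /predU1P[<- _|r0 r1]; first by rewrite dart_point0.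
have [|pf [pf' ->]] := @dart_pointE d r; first by rewrite r0.
by rewrite /dsrc; case: (d.2) => /=; [left|right; rewrite opprB addrC subrK].
Qed.

Lemma dart_point_tgt d r : 0 < r < 1 -> exits (dart_point d r) (dtgt d, 1 - r).
Proof.
move=> r01; have [pf [pf' ->]] := dart_pointE d r01.
by rewrite /dtgt; case: (d.2) => /=; [right|left].
Qed.

Lemma dart_point_segment d r r' : 0 < r < 1 -> 0 < r' < 1 ->
  segment_length (dart_point d r) (dart_point d r') `|r - r'|.
Proof.
move=> r01 r01'; have [pf [pf' ->]] := dart_pointE d r01.
have [qf [qf' ->]] := dart_pointE d r01'.
case: (d.2) => //=; split => //; rewrite -normrN; congr `|_|; lra.
Qed.

Lemma potential_dart u d r : 0 < r < 1 ->
  potential u (dart_point d r) = Num.min ((vdist u (dsrc d))%:R + r) ((vdist u (dtgt d))%:R + (1 - r)).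
Proof.
move=> r01; have [pf [pf' ->]] := dart_pointE d r01.
by rewrite /dsrc /dtgt; case: (d.2) => //=; rewrite minC opprB [1 + (r - 1)]addrC subrK.
Qed.

(** Running at unit speed along a shortest walk is a geodesic of the
   realization: the arcs of the walk bound distances from above, the potential
   of its origin from below.  A point of that geodesic has on its edge an end
   that is at least as close to any given vertex [u]. *)
Lemma geodesic_of_trace n s : trace n s -> n = vdist (s 0%N) (s n) ->
  exists S : set point, [/\ geodesic (Vertex (s 0%N)) (Vertex (s n)) S,
    forall i, (i <= n)%N -> S (Vertex (s i)) &
    forall p, S p -> forall u, exists2 i, (i <= n)%N & (vdist u (s i))%:R <= potential u p].
Proof.
move=> st nE; have geo i : (i <= n)%N -> vdist (s 0%N) (s i) = i.
  by move=> lin; have [] := geodesic_trace st nE lin.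
have [d dP] : {d : nat -> option (dart X) & forall i, (i < n)%N ->
    exists2 e, d i = Some e & dsrc e = s i /\ dtgt e = s i.+1}.
  apply: (@choice _ _ (fun i d => (i < n)%N -> exists2 e, d = Some e & dsrc e = s i /\ dtgt e = s i.+1)).
  move=> i; have [lin|_] := boolP (i < n)%N; last by exists None.
  by have [e e1 e2] := st i lin; exists (Some e) => _; exists e.
pose c (t : R) : point := let i := Num.truncn t in
  if d i is Some e then if (i < n)%N then dart_point e (t - i%:R) else Vertex (s n)
  else Vertex (s n).
pose fl (t : R) := Num.truncn t.
have flP (t : R) : 0 <= t <= n%:R -> [/\ (fl t)%:R <= t, t < (fl t)%:R + 1 & (fl t <= n)%N].
  case/andP=> t0 tn; have /andP[h1 h2] := truncn_itv t0; rewrite -natr1 in h2.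
  by split => //; rewrite -(ler_nat R); apply: le_trans tn.
have cP (t : R) : 0 <= t <= n%:R -> [\/ (fl t < n)%N /\ exists e, [/\ d (fl t) = Some e,
      c t = dart_point e (t - (fl t)%:R), dsrc e = s (fl t) & dtgt e = s (fl t).+1] | [/\ t = n%:R, fl t = n & c t = Vertex (s n)]].
  move=> tn; have [h1 h2 h3] := flP t tn; rewrite /c -/(fl t).
  move: h3; rewrite leq_eqVlt => /predU1P[h3|lin]; last first.
    by left; have [e de [e1 e2]] := dP _ lin; split => //; exists e; rewrite de lin.
  by right; split => //; [move: h1; rewrite h3; lra|rewrite h3 ltnn; case: (d n)].
have cnat i : (i <= n)%N -> c i%:R = Vertex (s i).
  move=> lin; have := cP i%:R; rewrite ler0n ler_nat lin /fl natrK => /(_ isT)[].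
    by move=> [_ [e [_ -> e1 e2]]]; rewrite subrr dart_point0 e1.
  by move=> [_ -> ->].
have csrc (t : R) : 0 <= t <= n%:R -> exits (c t) (s (fl t), t - (fl t)%:R).
  move=> tn; have [h1 h2 h3] := flP t tn; case: (cP t tn) => [[_ [e [_ -> <- _]]]|[-> h4 ->]].
    by apply: dart_point_src; lra.
  by rewrite h4 subrr.
have cpot (t : R) : 0 <= t <= n%:R -> potential (s 0%N) (c t) = t.
  move=> tn; have [h1 h2 h3] := flP t tn.
  case: (cP t tn) => [[lin [e [_ -> e1 e2]]]|[-> h4 ->]] /=; last by rewrite -nE.
  move: (h1); rewrite le_eqVlt => /predU1P[h4|h4].
    have -> : t - (fl t)%:R = 0 by lra.
    by rewrite dart_point0 /= e1 geo.
  rewrite potential_dart; last lra.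
  rewrite e1 e2 !geo//.
  by rewrite -natr1; case: lerP; lra.
have upper (a b : R) : 0 <= a <= n%:R -> 0 <= b <= n%:R -> a <= b -> dist (c a) (c b) <= b - a.
  move=> an bn ab; have [a1 a2 a3] := flP a an; have [b1 b2 b3] := flP b bn.
  have ij : (fl a <= fl b)%N by apply: le_truncn.
  apply: dist_le_path.
  have csb := csrc b bn; have csa := csrc a an.
  move: (a1); rewrite le_eqVlt => /predU1P[a4|a4].
    left; exists (s (fl a)), (a - (fl a)%:R), (s (fl b)), (b - (fl b)%:R), (fl b - fl a)%N.
    split => //; first by apply: (walk_of_trace st); rewrite ij.
    by rewrite natrB// a4; lra.
  case: (cP a an) => [[lin [e [de ca e1 e2]]]|[a5 a6 _]]; last first.
    by move: a4; rewrite a6 a5 ltxx.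
  move: ij; rewrite leq_eqVlt => /predU1P[ij|ij].
    case: (cP b bn) => [[_ [e' [de' cb _ _]]]|[_ b4 _]]; last first.
      by move: lin; rewrite ij b4 ltnn.
    have {}de' : e' = e by apply: Some_inj; rewrite -de -de' ij.
    have -> : b - a = `|(a - (fl a)%:R) - (b - (fl b)%:R)|.
      by rewrite ij distrC ger0_norm; lra.
    right; rewrite ca cb de'; apply: dart_point_segment; first lra.
    by rewrite -ij in b1 b2 *; lra.
  left; exists (s (fl a).+1), (1 - (a - (fl a)%:R)), (s (fl b)), (b - (fl b)%:R), (fl b - (fl a).+1)%N.
  split => //; first by rewrite ca -e2; apply: dart_point_tgt; lra.
    by apply: (walk_of_trace st); rewrite ij.
  by rewrite natrB// -natr1; lra.
exists (c @` [set` `[0, n%:R]]); split.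
- exists n%:R, c; split => //.
  + exact: (cnat 0%N).
  + exact: cnat.
  + have main (a b : R) : 0 <= a <= n%:R -> 0 <= b <= n%:R -> a <= b -> dist (c a) (c b) = b - a.
      move=> an bn ab; apply/eqP; rewrite eq_le upper//=.
      have := potential_le_dist (s 0%N) (c b) (c a).
      by rewrite !cpot// dist_sym ger0_norm ?subr_ge0.
    move=> a b; rewrite !in_itv /= => an bn; case: (lerP a b) => ab.
      by rewrite main.
    by rewrite dist_sym main// ltW.
- move=> i lin; exists i%:R; last exact: cnat.
  by rewrite /= in_itv /= ler0n ler_nat.
- move=> p [t /= tn <- u]; move: tn; rewrite in_itv /= => tn; have [h1 h2 h3] := flP t tn.
  case: (cP t tn) => [[lin [e [_ -> e1 e2]]]|[_ _ ->]]; last by exists n.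
  move: (h1); rewrite le_eqVlt => /predU1P[h4|h4].
    have -> : t - (fl t)%:R = 0 by lra.
    by exists (fl t) => //; rewrite dart_point0 /= e1.
  rewrite potential_dart ?e1 ?e2; last lra.
  by case: lerP => _; [exists (fl t) => //|exists (fl t).+1 => //]; lra.
Qed.

Lemma geodesic_through x y (q : vertex X) : between x y q ->
  exists S : set point, [/\ geodesic (Vertex x) (Vertex y) S, S (Vertex q) &
    forall p, S p -> forall u, exists2 v, between x y v & (vdist u v)%:R <= potential u p].
Proof.
move=> xqy; have [s [s0 sn st sq]] := between_trace xqy.
have nE : vdist x y = vdist (s 0%N) (s (vdist x y)) by rewrite s0 sn.
have [S [geo Ss near]] := geodesic_of_trace st nE.
exists S; rewrite s0 sn in geo; split => //.
  by rewrite -sq; apply: Ss; move: xqy; rewrite /between; lia.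
move=> p Sp u; have [i lin ip] := near p Sp u; exists (s i) => //.
by have [_] := geodesic_trace st nE lin; rewrite s0 sn.
Qed.

Lemma thin_of_triangles (delta : R) : thin_triangles X delta ->
  thin (Num.truncn delta).
Proof.
move=> tri x y z q xqy.
have bx (v w : vertex X) : between v w v by rewrite /between vdistxx.
have [S1 [g1 Sq _]] := geodesic_through xqy.
have [S2 [g2 _ n2]] := geodesic_through (bx y z).
have [S3 [g3 _ n3]] := geodesic_through (bx z x).
have [/(_ _ Sq) [p Sp pd] _ _] := tri _ _ _ _ _ _ g1 g2 g3.
have pq : potential q p <= delta.
  apply: le_trans pd; apply: le_trans (potential_le_dist q _ _).
  by rewrite /= vdistxx sub0r normrN ler_norm.
have fin (q' : vertex X) : (vdist q q')%:R <= potential q p -> (vdist q q' <= Num.truncn delta)%N.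
  by move=> h; rewrite truncn_ge_nat ?(le_trans _ pq)// ?(le_trans _ h).
case: Sp => [/n2|/n3] /(_ q)[v vb vq]; exists v; [exact: fin|by left|exact: fin|by right].
Qed.

End Graph.

(** * Word length on the Cayley graph *)

Section Cayley.
Variables (G : groupType) (A : finType) (pi : A -> G).
Notation X := (cayley_graph pi).
Implicit Types (g h k : G).
Notation el := (coset_elt [set 1%g] : G -> vertex X).

Lemma coset_elt1_inj : injective (coset_elt [set (1%g : G)]).
Proof.
move=> g h /(congr1 val) /= /seteqP[gh _].
have [|_ -> ] := gh g; first by exists 1%g; rewrite ?mul1g.
by rewrite mul1g.
Qed.

Definition letter (l : A * bool) : G := if l.2 then pi l.1 else (pi l.1)^-1%g.

Lemma adjacent_letter g l : adjacent (el g) (el (g * letter l)%g).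
Proof.
case: l => a b; have sx : @star X (el g) (exit_dart (el g) (a, b)).
  by rewrite star_exit; apply/mapP; exists (a, b); rewrite ?mem_enum.
exists (exit_dart (el g) (a, b)) => //.
by rewrite dtgt_exit coset_elt_mul.
Qed.

Lemma adjacent_cayley g (y : vertex X) : adjacent (el g) y ->
  exists l, y = el (g * letter l)%g.
Proof.
case=> d dg <-; have : @star X (el g) d by [].
rewrite star_exit => /mapP[[a b] _ ->]; exists (a, b).
by rewrite dtgt_exit coset_elt_mul.
Qed.

(** A walk spells a word, which can be read from any other vertex: left
   translations are automorphisms of the Cayley graph. *)
Lemma walk_cayley n g (y : vertex X) : walk n (el g) y ->
  exists2 h, y = el (g * h)%g & forall k, walk n (el k) (el (k * h)%g).
Proof.
elim: n g => [g <-|n IH g [d dg wy]]; first by exists 1%g => [|k]; rewrite mulg1.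
have [l dl] := adjacent_cayley (ex_intro2 _ _ d dg erefl); rewrite dl in wy.
have [h -> wh] := IH _ wy; exists (letter l * h)%g; first by rewrite mulgA.
move=> k; have [e ek el] := adjacent_letter k l.
by exists e => //; rewrite el mulgA; apply: wh.
Qed.

Lemma walk_translate n k g h : walk n (el g) (el h) -> walk n (el (k * g)%g) (el (k * h)%g).
Proof.
move=> /walk_cayley[x /coset_elt1_inj -> wx]; rewrite mulgA; exact: wx.
Qed.

Hypothesis gen : generates pi.

Lemma cayley_connected (x y : vertex X) : exists n, walk n x y.
Proof.
pose K : set G := [set g | exists n, walk n (el 1%g) (el g)].
have KT : K = setT.
  apply: gen.
    split; first by apply/mem_set; exists 0%N.
    move=> g h /set_mem[n gn] /set_mem[m hm]; apply/mem_set; exists (n + m)%N.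
    apply: walk_cat gn _; apply: walk_sym.
    by have := walk_translate (g * h^-1)%g hm; rewrite mulg1 mulgVK.
  move=> _ [a _ <-]; exists 1%N; apply: walk_adjacent.
  by have := adjacent_letter 1%g (a, true); rewrite mul1g.
have [g ->] := coset_eltP x; have [h ->] := coset_eltP y.
have [n w] : K (g^-1 * h)%g by rewrite KT.
by exists n; have := walk_translate g w; rewrite mulg1 mulVKg.
Qed.

Local Notation vd := (vdist cayley_connected).

Definition word_len g : nat := vd (el 1%g) (el g).

Lemma vdist_translate k g h : vd (el (k * g)%g) (el (k * h)%g) = vd (el g) (el h).
Proof.
apply/eqP; rewrite eqn_leq; apply/andP; split; apply: vdist_le.
  by apply: walk_translate; apply: vdist_walk.
by have := walk_translate k^-1%g (vdist_walk cayley_connected (el (k * g)%g) (el (k * h)%g)); rewrite !mulKg.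
Qed.

Lemma ldist_cayley g h : ldist word_len g h = vd (el g) (el h).
Proof. by rewrite /ldist /word_len -(vdist_translate g) mulg1 mulVKg. Qed.

Lemma word_len_split g i : (i <= word_len g)%N -> exists a b,
  [/\ g = (a * b)%g, word_len a = i & word_len b = word_len g - i]%N.
Proof.
move=> ig.
have b1 : between cayley_connected (el 1%g) (el g) (el 1%g).
  by rewrite /between vdistxx.
have [s [s0 sn st _]] := between_trace b1.
have nE : word_len g = vd (s 0%N) (s (word_len g)) by rewrite s0 sn.
have [] := geodesic_trace st nE ig; rewrite s0 sn; have [a ->] := coset_eltP (s i).
rewrite /between => ai ab; exists a, (a^-1 * g)%g; split => //; first by rewrite mulVKg.
rewrite -/(ldist word_len a g) ldist_cayley; move: ab; rewrite ai /word_len.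
by move=> <-; rewrite addKn.
Qed.

Lemma word_length_cayley : word_length word_len.
Proof.
have lM g h : (word_len (g * h)%g <= word_len g + word_len h)%N.
  rewrite {3}/word_len -(vdist_translate g) mulg1; exact: vdist_tri.
have ball1 g : (word_len g <= 1)%N -> g \in 1%g :: [seq letter l | l <- enum {: A * bool}].
  rewrite leq_eqVlt => /predU1P[|]; rewrite inE.
    rewrite /word_len => e; have := vdist_walk cayley_connected (el 1%g) (el g).
    rewrite e => -[d d1 dg].
    have [l /coset_elt1_inj ->] := adjacent_cayley (ex_intro2 _ _ d d1 dg).
    by rewrite mul1g map_f ?orbT// mem_enum.
  rewrite ltnS leqn0 => /eqP; rewrite /word_len => e.
  have := vdist_walk cayley_connected (el 1%g) (el g); rewrite e => /coset_elt1_inj <-.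
  by rewrite eqxx.
split => //.
- exact: vdistxx.
- move=> g; rewrite /word_len -(vdist_translate g) mulgV mulg1; exact: vdist_sym.
- elim=> [|n [s sP]].
    by exists (1%g :: [seq letter l | l <- enum {: A * bool}]) => g g0; apply: ball1; apply: leq_trans g0 _.
  exists [seq (a * b)%g | a <- s, b <- 1%g :: [seq letter l | l <- enum {: A * bool}]].
  move=> g gn; have [a [b [gE la lb]]] := @word_len_split g (minn n (word_len g)) (geq_minr _ _).
  by rewrite gE; apply: allpairs_f; [apply: sP; lia|apply: ball1; lia].
- exact: word_len_split.
Qed.

End Cayley.

(** * The theorem *)

(** Without generators the group is trivial. *)
Lemma generators_nonempty (G : groupType) (A : finType) (pi : A -> G) :
  generates pi -> ~ virtually_cyclic G -> (0 < #|A|)%N.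
Proof.
move=> gen nvc; rewrite lt0n; apply/negP => /eqP/card0_eq A0; apply: nvc.
exists 1%g; apply: (finite_index_cobounded (word_length_cayley gen) (D := 0)).
  exact: cyclic_subgroupP.
have KT : cyclic_subgroup (1%g : G) = setT.
  apply: gen; first exact: cyclic_subgroupP.
  by move=> x [a _ _]; have := A0 a; rewrite inE.
move=> p; exists p; first by rewrite KT.
by rewrite (ldistxx (word_length_cayley gen)).
Qed.

Lemma hyperbolic_four_point (R : realType) (G : groupType) (A : finType) (pi : A -> G)
    (gen : generates pi) : word_hyperbolic R G -> exists k, four_point (word_len gen) k.
Proof.
move=> /(_ A pi gen)[delta _ tri]; have thinD := thin_of_triangles (conn := cayley_connected gen) tri.
exists (4 * Num.truncn delta + 2)%N => x y z w; rewrite !ldist_cayley.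
exact: thin_four_point.
Qed.

(** Each vertex between two elements of [H] lies on a geodesic of the
   realization joining them, so quasiconvexity applies to it. *)
Lemma quasiconvex_close (R : realType) (G : groupType) (A : finType) (pi : A -> G)
    (gen : generates pi) (H : set G) (HP : subgroup H) : quasiconvex R H ->
  exists e, forall h h' q, H h -> H h' ->
    (ldist (word_len gen) h q + ldist (word_len gen) q h' = ldist (word_len gen) h h')%N ->
    (coset_len (word_len gen) HP (coset_elt H q) <= e)%N.
Proof.
move=> /(_ A pi gen)[eps eps0 qc]; exists (Num.truncn eps) => h h' q Hh Hh'.
rewrite !ldist_cayley => hqh'.
have [S [geo Sq _]] := geodesic_through R hqh'.
have [_ [x Hx <-] xq] := qc h h' S Hh Hh' geo _ Sq.
have := potential_le_dist (cayley_connected gen) (coset_elt [set 1%g] q : vertex (cayley_graph pi))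
   (cayley_point R pi x) (cayley_point R pi q).
rewrite dist_sym => /le_trans /(_ xq); rewrite /= vdistxx subr0 ger0_norm// => le.
apply: leq_trans (coset_len_le (word_len gen) HP q Hx) _.
by rewrite ldist_cayley vdist_sym truncn_ge_nat.
Qed.

Theorem theorem1p2 (R : realType) (G : groupType) (A : finType) (pi : A -> G)
    (H : set G) :
  generates pi ->
  word_hyperbolic R G ->
  ~ virtually_cyclic G ->
  subgroup H ->
  quasiconvex R H ->
  ~ finite_index H ->
  nonamenable R (schreier_graph H pi).
Proof.
move=> gen hypR nvc HP qcR inf.
have wl := word_length_cayley gen.
have [k hyp] := hyperbolic_four_point gen hypR.
have [e qc] := quasiconvex_close gen HP qcR.
have [c tri] : exists c, forall L, tripod (word_len gen) c L.
  apply: contrapT => notri; apply: nvc; apply: (virtually_cyclic_of_no_tripod wl hyp) => c.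
  by apply/existsNP => tri; apply: notri; exists c.
have [T [E [N [M [N0 MN out inn]]]]] := coset_expansion wl hyp qc inf (tri _).
have poinc := poincare_of_expansion R (@coset_mul1 G H) (@coset_mulM G H) gen N0 MN out inn.
have A0 := generators_nonempty gen nvc.
have [lam lam01 contr] := markov_contract (@coset_mul1 G H) (@coset_mulM G H) A0 poinc.
exact: nonamenable_of_contract lam01 contr.
Qed.
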